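(* Let $\Omega\subset\mathbb{R}^2$ be a non-empty convex horn-shaped set with $|\Omega|<\infty$. If $\lambda\ge\lambda(\Omega)$ is a real number with $\mu(\Omega')\ge\frac12\lambda$, then for every $\varepsilon\in(0,|\Omega|\mu(\Omega'))$, $$\frac{1}{|\Omega|}\|u_{\Omega}\|_1^2\le 2\varepsilon+\frac{2|\Omega'|_{1}}{|\Omega|}\,|S|_1+\frac{2^{5/2}|\Omega'|_1^2}{|\Omega|}\big(|\Omega'|_1^2\lambda-\pi^2\big)^{-1/2}\Big(\log\big(\pi^2\varepsilon^{-1}|\Omega'|_1^{-2}|\Omega|\big)\Big)^{1/2},$$ where $$S=\Big\{x_1\in\mathbb{R}:\ \frac{|\Omega'|_1^2\,\mu(\Omega(x_1/2))-\pi^2}{2(|\Omega'|_1^2\lambda-\pi^2)}\le\log\big(4\pi^2\varepsilon^{-1}|\Omega'|_1^{-2}|\Omega|\big)\Big\}.$$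
   Context: Points of $\mathbb{R}^2$ are written $(x_1,x')$ with $x_1,x'\in\mathbb{R}$. For an open set $\Omega\subset\mathbb{R}^2$ put $\Omega(x_1)=\{x'\in\mathbb{R}:(x_1,x')\in\Omega\}$ and $\Omega'=\bigcup_{x_1\in\mathbb{R}}\Omega(x_1)\subset\mathbb{R}$. For a non-empty open set $D\subset\mathbb{R}$ of finite measure, $\mu(D)$ denotes the first eigenvalue of the one-dimensional Dirichlet Laplacian $-d^2/dx'^2$ on $L^2(D)$; by convention $\mu(\emptyset)=\infty$. A set $\Omega\subset\mathbb{R}^2$ is horn-shaped if it is open and connected, $x_1>x_2>0$ implies $\Omega(x_1)\subset\Omega(x_2)$, and $x_1<x_2<0$ implies $\Omega(x_1)\subset\Omega(x_2)$ (here $x_1,x_2$ are real numbers). $|\cdot|$ is Lebesgue measure in $\mathbb{R}^2$ and $|\cdot|_1$ is one-dimensional Lebesgue measure. $\lambda(\Omega)$ is the first eigenvalue of the Dirichlet Laplacian $-\Delta$ on $L^2(\Omega)$, and $u_\Omega\in H^1_0(\Omega)$ is the corresponding eigenfunction, chosen positive with $\|u_\Omega\|_2=1$; $\|\cdot\|_1$ applied to functions is the $L^1(\Omega)$ norm. *)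

(* Defs.v *)
From HB Require Import structures.
From mathcomp Require Import all_boot all_order all_algebra.
From mathcomp Require Import all_classical all_reals all_analysis.
Set Implicit Arguments.
Unset Strict Implicit.
Unset Printing Implicit Defensive.
Import Order.TTheory GRing.Theory Num.Theory.
Import numFieldNormedType.Exports.
Local Open Scope classical_set_scope.
Local Open Scope ring_scope.

Section test_functions.
Context (R : realType) (V : normedModType R).

Fixpoint iter_derive (f : V -> R) (vs : seq V) : V -> R :=
  if vs is v :: vs' then 'D_v (iter_derive f vs') else f.

Definition smooth (f : V -> R) := forall vs : seq V,
  continuous (iter_derive f vs) /\
  forall x v : V, derivable (iter_derive f vs) x v.

(* C_c^oo(D) *)
Definition test_function (D : set V) (f : V -> R) :=
  let supp := closure [set x | f x != 0] in
  [/\ smooth f, compact supp & supp `<=` D].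

End test_functions.

(* The one- and the two-dimensional Dirichlet Laplacian are the instances, at
   the end of the file, of the definitions of this section: T is R or R * R,
   [mu] is Lebesgue measure, [Cc D] is C_c^oo(D) and [partial i] is the i-th
   partial derivative. Functions on D are total functions whose values outside
   D are irrelevant. *)
Section dirichlet_laplacian.
Context (R : realType) (d : measure_display) (T : measurableType d).
Variables (mu : {measure set T -> \bar R}) (Cc : set T -> set (T -> R)).
Variables (n : nat) (partial : 'I_n -> (T -> R) -> T -> R).

Definition square_integrable (D : set T) (f : T -> R) :=
  measurable_fun D f /\ (\int[mu]_(x in D) ((f x) ^+ 2)%:E < +oo)%E.

Definition L2_cvg (D : set T) (f_ : nat -> T -> R) (f : T -> R) :=
  (\int[mu]_(x in D) ((f_ k x - f x) ^+ 2)%:E)%E @[k --> \oo] --> 0%E.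

(* u belongs to H^1_0(D), the closure of C_c^oo(D) in H^1(D), and its weak
   gradient is g. *)
Definition H10 (D : set T) (u : T -> R) (g : 'I_n -> T -> R) :=
  [/\ square_integrable D u,
      forall i, square_integrable D (g i) &
      exists phi : nat -> T -> R,
        [/\ forall k, Cc D (phi k),
            L2_cvg D phi u &
            forall i, L2_cvg D (fun k => partial i (phi k)) (g i)]].

(* -Delta u = f for the Dirichlet Laplacian on L^2(D), that is the self-adjoint
   operator associated with the form (u, w) |-> \int_D grad u . grad w on
   H^1_0(D). *)
Definition dirichlet_laplacian (D : set T) (u f : T -> R) :=
  square_integrable D f /\
  exists2 g, H10 D u g &
    forall w h, H10 D w h ->
      \int[mu]_(x in D) (\sum_(i < n) g i x * h i x) =
      \int[mu]_(x in D) (f x * w x).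

Definition dirichlet_eigenfunction (D : set T) (l : R) (u : T -> R) :=
  dirichlet_laplacian D u (fun x => l * u x) /\
  ~ {ae mu, forall x, D x -> u x = 0}.

Definition dirichlet_eigenvalue (D : set T) (l : R) :=
  exists u, dirichlet_eigenfunction D l u.

(* If D is open, non-empty and of finite measure, the spectrum is discrete and
   this infimum is the smallest eigenvalue. There is no eigenvalue if D is
   empty, and the infimum is then +oo. *)
Definition first_eigenvalue (D : set T) : \bar R :=
  ereal_inf [set l%:E | l in dirichlet_eigenvalue D].

Definition normalized_first_eigenfunction (D : set T) (u : T -> R) :=
  [/\ exists2 l, l%:E = first_eigenvalue D & dirichlet_eigenfunction D l u,
      {ae mu, forall x, D x -> 0 < u x} &
      (\int[mu]_(x in D) ((u x) ^+ 2)%:E = 1)%E].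

End dirichlet_laplacian.

Section plane.
Context (R : realType).

(* [measurableTypeR R] is R with the Borel sigma-algebra, on which
   [lebesgue_measure] is defined. *)
Notation RB := (measurableTypeR R).

Definition leb1 : {measure set RB -> \bar R} := lebesgue_measure.

Definition leb2 : {measure set (RB * RB) -> \bar R} :=
  (lebesgue_measure \x lebesgue_measure)%E.

Definition partial1 (i : 'I_1) (f : RB -> R) : RB -> R :=
  derive1 (f : R -> R).

Definition partial2 (i : 'I_2) (f : RB * RB -> R) : RB * RB -> R :=
  'D_(if i == 0 then (1, 0) else (0, 1)) (f : R * R -> R).

Definition test1 : set RB -> set (RB -> R) := @test_function R R.

Definition test2 : set (RB * RB) -> set (RB * RB -> R) :=
  @test_function R (R * R)%type.

Definition mu1 (D : set R) : \bar R :=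
  first_eigenvalue leb1 test1 partial1 D.

Definition lambda1 (D : set (R * R)) : \bar R :=
  first_eigenvalue leb2 test2 partial2 D.

Definition is_ground_state (D : set (R * R)) (u : R * R -> R) :=
  normalized_first_eigenfunction leb2 test2 partial2 D u.

(* The section of [Omega] over x1 is [xsection Omega x1]. *)
Definition sections_union (Omega : set (R * R)) : set R :=
  \bigcup_(x1 in [set: R]) xsection Omega x1.

Definition horn_shaped (Omega : set (R * R)) :=
  [/\ open Omega, connected Omega,
      forall x1 x2 : R, 0 < x2 -> x2 < x1 ->
        xsection Omega x1 `<=` xsection Omega x2 &
      forall x1 x2 : R, x1 < x2 -> x2 < 0 ->
        xsection Omega x1 `<=` xsection Omega x2].

End plane.

(* Main.v *)
(* The set Omega is bounded, so the exponential weight e^(2 b x_1) u is an admissible test function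
   for the eigenvalue equation. Together with the one-dimensional Poincare inequality on vertical
   sections it gives Agmon's estimate: the mass of u in {|x_1| >= r} decays like e^(-b r) as soon as
   the section over r / 2 is narrow, and every r outside S has this property because the first
   eigenvalue of an interval of length d is at most (pi / d)^2. With X_0^2 = 2 K / (lam - pi^2 / L^2),
   where K is the last logarithm of the statement, choose r_1, r_2 >= X_0 with r_1, -r_2 outside S
   and r_1 + r_2 close to |S| + 2 X_0. By Cauchy-Schwarz ||u||_1^2 is then at most
   2 |Omega /\ {-r_2 < x_1 < r_1}| plus 2 |Omega| times the mass outside that strip. That mass is at
   most eps because |Omega| pi^2 / L^2 >= 4, which follows from lam <= 2 pi^2 / L^2 and from
   lambda(Omega) |Omega| >= 8, a consequence of 4 ||f||_2^2 <= ||f_x||_1 ||f_y||_1. *)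

Require Import Defs.
From mathcomp Require Import all_boot all_order all_algebra.
From mathcomp Require Import all_classical all_reals all_analysis measurable_realfun.
From mathcomp Require Import ring lra.
Set Implicit Arguments.
Unset Strict Implicit.
Unset Printing Implicit Defensive.
Import Order.TTheory GRing.Theory Num.Theory.
Import numFieldNormedType.Exports.
Local Open Scope classical_set_scope.
Local Open Scope ring_scope.

(** A function of H^1_0 is accessible only through its approximating test functions, so every
    inequality is proved for C_c^oo by calculus on lines and then passed to the limit. The
    transition at r / 2 in Agmon's estimate is sharp, an indicator of x_1 instead of a smooth
    cutoff: the Poincare inequality on sections differentiates in x' alone, and any bounded
    measurable function of x_1 commutes with that derivative, while the horizontal derivative enters
    the energy identity as a square that is dropped. In the estimates the first eigenvalue of a
    section is replaced by the length of an interval that contains it, where the sharp Poincare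
    inequality is elementary. The logarithm in S exceeds K by log 4 >= 1; this surplus pays for the
    distance from m = (pi / L)^2 to the eigenvalue and leaves at least lam - m in front of the tail,
    however small K is. Measurability of S is not at hand, so S is compared with intervals that it
    contains, and r_1, r_2 are taken close to infima; the arbitrarily small loss disappears at the
    very end. *)

(** * Square integrable functions and limits of their inner products *)

Section square_integrable_theory.
Context (R : realType) (d : measure_display) (T : measurableType d).
Variables (mu : {measure set T -> \bar R}) (D : set T).
Hypothesis mD : measurable D.
Implicit Types f g : T -> R.

Notation sqint := (square_integrable mu D).

Lemma sqint_measurable f : sqint f -> measurable_fun D f.
Proof. by case. Qed.

Lemma sqint_integrable_sqr f : sqint f ->
  mu.-integrable D (EFin \o (fun x => f x ^+ 2)).
Proof.
move=> [mf fi]; apply/integrableP; split.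
  by apply/measurable_EFinP; exact: measurable_funX.
by under eq_integral do rewrite /= ger0_norm ?sqr_ge0//.
Qed.

Lemma sqint_le f (h : T -> R) : measurable_fun D f ->
  mu.-integrable D (EFin \o h) ->
  (forall x, D x -> f x ^+ 2 <= h x) -> sqint f.
Proof.
move=> mf /integrableP[mh ih] fh; split => //.
apply: le_lt_trans ih; apply: ge0_le_integral => //.
- by move=> x _; rewrite lee_fin sqr_ge0.
- by apply/measurable_EFinP; exact: measurable_funX.
- exact: measurableT_comp.
- by move=> x Dx /=; rewrite lee_fin (le_trans (fh _ Dx)) ?ler_norm.
Qed.

Lemma sqint_integrable_mul f g : sqint f -> sqint g ->
  mu.-integrable D (EFin \o (fun x => f x * g x)).
Proof.
move=> sf sg.
apply: (@le_integrable _ _ _ mu D mD _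
  (EFin \o (fun x => f x ^+ 2 + g x ^+ 2))).
- apply/measurable_EFinP; apply: measurable_funM; exact: sqint_measurable.
- move=> x Dx /=; rewrite lee_fin normrM [leRHS]ger0_norm ?addr_ge0 ?sqr_ge0//.
  have := sqr_ge0 (`|f x| - `|g x|).
  rewrite -(real_normK (num_real (f x))) -(real_normK (num_real (g x))).
  have := mulr_ge0 (normr_ge0 (f x)) (normr_ge0 (g x)); nra.
- have := integrableD mD (sqint_integrable_sqr sf) (sqint_integrable_sqr sg).
  exact: eq_integrable.
Qed.

Lemma sqintD f g : sqint f -> sqint g -> sqint (fun x => f x + g x).
Proof.
move=> sf sg.
apply: (@sqint_le _ (fun x => 2 * (f x ^+ 2 + g x ^+ 2))).
- by apply: measurable_funD; exact: sqint_measurable.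
- have := integrableZl mD 2 (integrableD mD (sqint_integrable_sqr sf) (sqint_integrable_sqr sg)).
  by apply: eq_integrable => // x _ /=; rewrite -EFinD -EFinM.
- by move=> x _; have := sqr_ge0 (f x - g x); nra.
Qed.

Lemma sqint_bounded_mul (h : T -> R) M f : measurable_fun D h ->
  (forall x, D x -> `|h x| <= M) -> sqint f -> sqint (fun x => h x * f x).
Proof.
move=> mh hM sf.
apply: (@sqint_le _ (fun x => M ^+ 2 * f x ^+ 2)).
- by apply: measurable_funM => //; exact: sqint_measurable.
- have := integrableZl mD (M ^+ 2) (sqint_integrable_sqr sf).
  by apply: eq_integrable => // x _ /=; rewrite -EFinM.
- move=> x Dx; rewrite exprMn ler_wpM2r ?sqr_ge0//.
  by rewrite -(real_normK (num_real (h x))) lerXn2r ?nnegrE ?(le_trans _ (hM x Dx)) ?hM.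
Qed.

Lemma sqintZ k f : sqint f -> sqint (fun x => k * f x).
Proof. by apply: (@sqint_bounded_mul (cst k) `|k|). Qed.

Lemma sqintB f g : sqint f -> sqint g -> sqint (fun x => f x - g x).
Proof.
move=> sf sg; have := sqintD sf (sqintZ (-1) sg).
by under eq_fun do rewrite mulN1r.
Qed.

Lemma sqint_bounded f M : (mu D < +oo)%E -> measurable_fun D f ->
  (forall x, D x -> `|f x| <= M) -> sqint f.
Proof.
move=> Doo mf fM; apply: (@sqint_le _ (fun _ => M ^+ 2)) => //.
- apply/integrableP; split; first exact/measurable_EFinP/measurable_cst.
  rewrite [ltLHS](_ : _ = (`|M ^+ 2|%:E * mu D)%E) -?integral_cst//.
  by rewrite integral_cst// lte_mul_pinfty.
- move=> x Dx; rewrite -(real_normK (num_real (f x))).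
  by rewrite lerXn2r ?nnegrE ?(le_trans _ (fM x Dx)) ?fM.
Qed.

(** The squared L^2 norm as a real number; [fine] turns an infinite integral into 0, so the value is
    meaningful for square integrable f. *)
Definition nrm2 f := \int[mu]_(x in D) (f x ^+ 2).

Lemma nrm2_ge0 f : 0 <= nrm2 f.
Proof. by apply: Rintegral_ge0 => x _; exact: sqr_ge0. Qed.

Lemma nrm2E f : sqint f -> (\int[mu]_(x in D) (f x ^+ 2)%:E)%E = (nrm2 f)%:E.
Proof.
move=> sf; rewrite /nrm2 /Rintegral fineK//.
exact: integrable_fin_num (sqint_integrable_sqr sf).
Qed.

Lemma Rint_mulC f g : \int[mu]_(x in D) (f x * g x) = \int[mu]_(x in D) (g x * f x).
Proof. by under eq_Rintegral do rewrite mulrC. Qed.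

Lemma Rint_mulDl f g h : sqint f -> sqint g -> sqint h ->
  \int[mu]_(x in D) ((f x + g x) * h x) =
  \int[mu]_(x in D) (f x * h x) + \int[mu]_(x in D) (g x * h x).
Proof.
move=> sf sg sh; rewrite -RintegralD//; last 2 first.
- exact: sqint_integrable_mul.
- exact: sqint_integrable_mul.
by under eq_Rintegral do rewrite mulrDl.
Qed.

Lemma Rint_mulDr f g h : sqint f -> sqint g -> sqint h ->
  \int[mu]_(x in D) (h x * (f x + g x)) =
  \int[mu]_(x in D) (h x * f x) + \int[mu]_(x in D) (h x * g x).
Proof. by move=> sf sg sh; rewrite !(Rint_mulC h) Rint_mulDl. Qed.

Lemma Rint_mulZl k f h : sqint f -> sqint h ->
  \int[mu]_(x in D) (k * f x * h x) = k * \int[mu]_(x in D) (f x * h x).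
Proof.
move=> sf sh; rewrite -RintegralZl//; last exact: sqint_integrable_mul.
by under eq_Rintegral do rewrite -mulrA.
Qed.

Lemma nrm2DZ k f g : sqint f -> sqint g ->
  nrm2 (fun x => k * f x + g x) =
  k ^+ 2 * nrm2 f + 2 * k * (\int[mu]_(x in D) (f x * g x)) + nrm2 g.
Proof.
move=> sf sg; rewrite /nrm2.
have skf := sqintZ k sf.
under eq_Rintegral do rewrite expr2.
rewrite Rint_mulDl//; last exact: sqintD.
rewrite [X in _ + X]Rint_mulC [X in X + _]Rint_mulC !Rint_mulDl//.
rewrite [\int[mu]_(_ in D) (g _ * (k * _))]Rint_mulC !Rint_mulZl//.
rewrite [\int[mu]_(_ in D) (f _ * (k * _))]Rint_mulC !Rint_mulZl//.
rewrite (_ : \int[mu]_(x in D) (f x ^+ 2) = \int[mu]_(x in D) (f x * f x)); last first.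
  by under eq_Rintegral do rewrite expr2.
rewrite (_ : \int[mu]_(x in D) (g x ^+ 2) = \int[mu]_(x in D) (g x * g x)); last first.
  by under eq_Rintegral do rewrite expr2.
ring.
Qed.

(** The quadratic k |-> ||k f + g||^2 is non-negative: evaluate it at its minimiser or, if ||f|| = 0
    and b is not 0, at a k where it would be -1. *)
Lemma cauchy_schwarz f g : sqint f -> sqint g ->
  (\int[mu]_(x in D) (f x * g x)) ^+ 2 <= nrm2 f * nrm2 g.
Proof.
move=> sf sg; set b := \int[mu]_(x in D) _.
have H k : 0 <= k ^+ 2 * nrm2 f + 2 * k * b + nrm2 g.
  by rewrite -nrm2DZ//; exact: nrm2_ge0.
have := nrm2_ge0 f; rewrite le_eqVlt => /predU1P[f0|f0].
  rewrite -f0 in H *; rewrite mul0r.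
  have [->|b0] := eqVneq b 0; first by rewrite expr0n.
  have := H (- (nrm2 g + 1) / (2 * b)).
  rewrite (_ : _ + _ = -1); last by field.
  by rewrite ler0N1.
have := H (- b / nrm2 f).
rewrite (_ : _ + _ = nrm2 g - b ^+ 2 / nrm2 f); last by field; rewrite gt_eqF.
by rewrite subr_ge0 ler_pdivrMr// mulrC.
Qed.

Lemma norm_Rint_mul f g : sqint f -> sqint g ->
  `|\int[mu]_(x in D) (f x * g x)| <= Num.sqrt (nrm2 f) * Num.sqrt (nrm2 g).
Proof.
move=> sf sg; rewrite -sqrtrM ?nrm2_ge0// -sqrtr_sqr.
by rewrite ler_wsqrtr// cauchy_schwarz.
Qed.

Lemma L2_cvg_nrm2 (f_ : nat -> T -> R) f : (forall k, sqint (f_ k)) -> sqint f ->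
  L2_cvg mu D f_ f <-> nrm2 (fun x => f_ k x - f x) @[k --> \oo] --> (0 : R).
Proof.
move=> sfk sf; rewrite /L2_cvg.
have -> : (fun k => \int[mu]_(x in D) ((f_ k x - f x) ^+ 2)%:E)%E =
    EFin \o (fun k => nrm2 (fun x => f_ k x - f x)).
  by apply/funext => k /=; rewrite nrm2E//; exact: sqintB.
split => [/fine_cvg//|H]; apply: cvg_EFin => //; exact: nearW.
Qed.

(* f_k g_k - f g = (f_k - f)(g_k - g) + (f_k - f) g + f (g_k - g). *)
Lemma cvg_Rint_mul (f_ g_ : nat -> T -> R) f g :
  (forall k, sqint (f_ k)) -> sqint f -> (forall k, sqint (g_ k)) -> sqint g ->
  L2_cvg mu D f_ f -> L2_cvg mu D g_ g ->
  \int[mu]_(x in D) (f_ k x * g_ k x) @[k --> \oo] --> \int[mu]_(x in D) (f x * g x).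
Proof.
move=> sfk sf sgk sg /(L2_cvg_nrm2 sfk sf) cf /(L2_cvg_nrm2 sgk sg) cg.
pose e k := nrm2 (fun x => f_ k x - f x); pose h k := nrm2 (fun x => g_ k x - g x).
have ce : Num.sqrt (e k) @[k --> \oo] --> (0 : R).
  rewrite -sqrtr0; apply: (continuous_cvg _ (@sqrt_continuous R 0) cf).
have ch : Num.sqrt (h k) @[k --> \oo] --> (0 : R).
  rewrite -sqrtr0; apply: (continuous_cvg _ (@sqrt_continuous R 0) cg).
have se k : sqint (fun x => f_ k x - f x) by exact: sqintB.
have sh k : sqint (fun x => g_ k x - g x) by exact: sqintB.
pose I := \int[mu]_(x in D) (f x * g x).
suff : (\int[mu]_(x in D) (f_ k x * g_ k x) - I) @[k --> \oo] --> (0 : R).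
  by move/subr_cvg0.
apply: norm_cvg0.
apply: (@squeeze_cvgr _ _ _ _ (cst 0) (fun k => Num.sqrt (e k) * Num.sqrt (h k)
   + Num.sqrt (e k) * Num.sqrt (nrm2 g) + Num.sqrt (nrm2 f) * Num.sqrt (h k))).
- near=> k; rewrite normr_ge0 /=.
  have -> : \int[mu]_(x in D) (f_ k x * g_ k x) - I =
    \int[mu]_(x in D) ((f_ k x - f x) * (g_ k x - g x)) +
    \int[mu]_(x in D) ((f_ k x - f x) * g x) + \int[mu]_(x in D) (f x * (g_ k x - g x)).
    have E : \int[mu]_(x in D) (f_ k x * g_ k x) =
      \int[mu]_(x in D) (((f_ k x - f x) + f x) * ((g_ k x - g x) + g x)).
      by under [RHS]eq_Rintegral do rewrite !subrK.
    rewrite E Rint_mulDl//; last exact: sqintD.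
    by rewrite !(Rint_mulDr (sh k) sg)// /I; ring.
  by do 2 (apply: le_trans (ler_normD _ _) _; apply: lerD; last exact: norm_Rint_mul);
     exact: norm_Rint_mul.
- exact: cvg_cst.
- rewrite -[X in _ --> X](_ : 0 * 0 + 0 * Num.sqrt (nrm2 g) + Num.sqrt (nrm2 f) * 0 = 0); last by ring.
  apply: cvgD; [apply: cvgD|]; apply: cvgM => //; exact: cvg_cst.
Unshelve. all: by end_near. Qed.

Lemma cvg_nrm2 (f_ : nat -> T -> R) f : (forall k, sqint (f_ k)) -> sqint f ->
  L2_cvg mu D f_ f -> nrm2 (f_ k) @[k --> \oo] --> nrm2 f.
Proof.
move=> sfk sf cf; rewrite /nrm2 [X in _ --> X](_ : _ = \int[mu]_(x in D) (f x * f x)).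
  have := cvg_Rint_mul sfk sf sfk sf cf cf.
  by apply: cvg_trans; apply: near_eq_cvg; near=> k; apply: eq_Rintegral => x _; rewrite expr2.
by apply: eq_Rintegral => x _; rewrite expr2.
Unshelve. all: by end_near. Qed.

Lemma le_nrm2 f g : sqint f -> sqint g ->
  (forall x, D x -> f x ^+ 2 <= g x ^+ 2) -> nrm2 f <= nrm2 g.
Proof. by move=> sf sg fg; apply: le_Rintegral => //; exact: sqint_integrable_sqr. Qed.

Lemma nrm2Z k f : sqint f -> nrm2 (fun x => k * f x) = k ^+ 2 * nrm2 f.
Proof.
move=> sf; rewrite /nrm2 -RintegralZl//; last exact: sqint_integrable_sqr.
by under eq_Rintegral do rewrite exprMn.
Qed.

Lemma L2_cvgD (f_ g_ : nat -> T -> R) f g :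
  (forall k, sqint (f_ k)) -> sqint f -> (forall k, sqint (g_ k)) -> sqint g ->
  L2_cvg mu D f_ f -> L2_cvg mu D g_ g ->
  L2_cvg mu D (fun k x => f_ k x + g_ k x) (fun x => f x + g x).
Proof.
move=> sfk sf sgk sg /(L2_cvg_nrm2 sfk sf) cf /(L2_cvg_nrm2 sgk sg) cg.
apply/L2_cvg_nrm2; [by move=> k; exact: sqintD|exact: sqintD|].
have se k : sqint (fun x => f_ k x - f x) by exact: sqintB.
have sh k : sqint (fun x => g_ k x - g x) by exact: sqintB.
apply: (@squeeze_cvgr _ _ _ _ (cst 0) (fun k => 2 * (nrm2 (fun x => f_ k x - f x) +
   nrm2 (fun x => g_ k x - g x)))).
- near=> k; rewrite nrm2_ge0 /=.
  have -> : nrm2 (fun x => f_ k x + g_ k x - (f x + g x)) =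
      nrm2 (fun x => 1 * (f_ k x - f x) + (g_ k x - g x)).
    by apply: eq_Rintegral => x _; congr (_ ^+ 2); ring.
  (* Parallelogram law: the squared norms of the sum and of the difference add up to twice the sum
     of the squared norms. *)
  have H1 := nrm2DZ 1 (se k) (sh k); have H2 := nrm2DZ (-1) (se k) (sh k).
  have := nrm2_ge0 (fun x => -1 * (f_ k x - f x) + (g_ k x - g x)).
  by rewrite H1 H2; nra.
- exact: cvg_cst.
- rewrite -[X in _ --> X](_ : 2 * (0 + 0) = 0); last by ring.
  by apply: cvgM; [exact: cvg_cst|exact: cvgD].
Unshelve. all: by end_near. Qed.

Lemma L2_cvg_bounded_mul (h : T -> R) M (f_ : nat -> T -> R) f :
  measurable_fun D h -> (forall x, D x -> `|h x| <= M) ->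
  (forall k, sqint (f_ k)) -> sqint f -> L2_cvg mu D f_ f ->
  L2_cvg mu D (fun k x => h x * f_ k x) (fun x => h x * f x).
Proof.
move=> mh hM sfk sf /(L2_cvg_nrm2 sfk sf) cf.
have S g : sqint g -> sqint (fun x => h x * g x) by exact: sqint_bounded_mul hM.
apply/L2_cvg_nrm2; [by move=> k; exact: S|exact: S|].
have se k : sqint (fun x => f_ k x - f x) by exact: sqintB.
apply: (@squeeze_cvgr _ _ _ _ (cst 0) (fun k => M ^+ 2 * nrm2 (fun x => f_ k x - f x))).
- near=> k; rewrite nrm2_ge0 /= -nrm2Z//.
  apply: le_nrm2 => //; [by apply: sqintB; exact: S|exact: sqintZ|].
  move=> x Dx; rewrite -mulrBr !exprMn ler_wpM2r ?sqr_ge0//.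
  by rewrite -(real_normK (num_real (h x))) lerXn2r ?nnegrE ?(le_trans _ (hM x Dx)) ?hM.
- exact: cvg_cst.
- rewrite -[X in _ --> X](_ : M ^+ 2 * 0 = 0); last by ring.
  by apply: cvgM => //; exact: cvg_cst.
Unshelve. all: by end_near. Qed.

Lemma L2_cvgZ k (f_ : nat -> T -> R) f :
  (forall n, sqint (f_ n)) -> sqint f -> L2_cvg mu D f_ f ->
  L2_cvg mu D (fun n x => k * f_ n x) (fun x => k * f x).
Proof. by apply: (@L2_cvg_bounded_mul (cst k) `|k|). Qed.

End square_integrable_theory.

(** * Directional derivatives, smooth functions and test functions *)

Section smooth_functions.
Context (R : realType) (V : normedModType R).
Implicit Types f g : V -> R.

Lemma is_derive_add x v f g (a b : R) : is_derive x v f a -> is_derive x v g b ->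
  is_derive x v (fun y => f y + g y) (a + b).
Proof. exact: is_deriveD. Qed.

Lemma is_derive_mul x v f g (a b : R) : is_derive x v f a -> is_derive x v g b ->
  is_derive x v (fun y => f y * g y) (f x * b + g x * a).
Proof. exact: is_deriveM. Qed.

Lemma is_derive_scale x v k f (a : R) : is_derive x v f a ->
  is_derive x v (fun y => k * f y) (k * a).
Proof. exact: is_deriveZ. Qed.

Lemma is_derive_line x v f (a : R) :
  is_derive x v f a <-> is_derive (0 : R) 1 (fun t : R => f (t *: v + x)) a.
Proof.
have E : (fun h : R => h^-1 *: ((f \o shift x) (h *: v) - f x)) =
  (fun h : R => h^-1 *: (((fun t : R => f (t *: v + x)) \o shift (0 : R)) (h *: (1 : R))
     - f ((0 : R) *: v + x))).
  by apply/funext => h /=; rewrite addr0 scale0r add0r [_%:A]mulr1.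
by split => -[d1 d2]; split; move: d1 d2; rewrite /derivable /derive E.
Qed.

Lemma is_derive_line_at x v f (t a : R) : is_derive (t *: v + x) v f a ->
  is_derive t 1 (fun t : R => f (t *: v + x)) a.
Proof.
move=> /is_derive_line H.
have H2 : is_derive t 1 (fun s : R => s - t) (1 : R).
  by have := is_derive_shift t (1 : R) (- t).
have H1 : is_derive (t - t) 1 (fun s : R => f (s *: v + (t *: v + x))) a by rewrite subrr.
have := @is_derive1_comp _ (fun s : R => f (s *: v + (t *: v + x))) (fun s => s - t) t a 1 H1 H2.
rewrite mulr1.
congr (is_derive _ _ _ _); apply/funext => s /=.
by rewrite addrA -scalerDl subrK.
Qed.

Lemma iter_derive_rcons f v vs : iter_derive ('D_v f) vs = iter_derive f (rcons vs v).
Proof. by elim: vs => //= w vs ->. Qed.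

Lemma smooth_derive f v : smooth f -> smooth ('D_v f).
Proof. by move=> sf vs; rewrite iter_derive_rcons. Qed.

Lemma smooth_continuous f : smooth f -> continuous f.
Proof. by move=> /(_ [::])[]. Qed.

Lemma smooth_is_derive f x v : smooth f -> is_derive x v f ('D_v f x).
Proof. by move=> /(_ [::])[_ /(_ x v) sf]; exact: derivableP. Qed.

Lemma continuous_add f g : continuous f -> continuous g ->
  continuous (fun x => f x + g x).
Proof. by move=> cf cg x; apply: cvgD; [exact: cf|exact: cg]. Qed.

Lemma continuous_mul f g : continuous f -> continuous g ->
  continuous (fun x => f x * g x).
Proof. by move=> cf cg x; apply: cvgM; [exact: cf|exact: cg]. Qed.

Lemma iter_deriveD f g vs : smooth f -> smooth g ->
  iter_derive (fun x => f x + g x) vs = fun x => iter_derive f vs x + iter_derive g vs x.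
Proof.
move=> sf sg; elim: vs => //= v vs ->; apply/funext => x.
have [_ /(_ x v) /derivableP df] := sf vs.
have [_ /(_ x v) /derivableP dg] := sg vs.
by have [_] := is_derive_add df dg.
Qed.

Lemma smoothD f g : smooth f -> smooth g -> smooth (fun x => f x + g x).
Proof.
move=> sf sg vs; rewrite iter_deriveD//.
have [cf df] := sf vs; have [cg dg] := sg vs.
split => [|x v]; first exact: continuous_add.
by have [] := is_derive_add (derivableP (df x v)) (derivableP (dg x v)).
Qed.

Lemma iter_deriveZ k f vs : smooth f ->
  iter_derive (fun x => k * f x) vs = fun x => k * iter_derive f vs x.
Proof.
move=> sf; elim: vs => //= v vs ->; apply/funext => x.
have [_ /(_ x v) /derivableP df] := sf vs.
by have [_] := is_derive_scale k df.
Qed.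

Lemma smoothZ k f : smooth f -> smooth (fun x => k * f x).
Proof.
move=> sf vs; rewrite iter_deriveZ//; have [cf df] := sf vs.
split => [|x v]; first by apply: continuous_mul => // y; exact: cvg_cst.
by have [] := is_derive_scale k (derivableP (df x v)).
Qed.

(** The exponential of a linear form: D_v (e g) = e (D_v g + l(v) g), so each iterated derivative of
    e f is again e times a smooth function. *)
Lemma smooth_exp_mul (e : V -> R) (l : V -> R) f : continuous e ->
  (forall x v, is_derive x v e (l v * e x)) -> smooth f ->
  smooth (fun x => e x * f x).
Proof.
move=> ce de sf vs.
have [g sg ->] : exists2 g, smooth g & iter_derive (fun x => e x * f x) vs = fun x => e x * g x.
  elim: vs => /= [|v vs [g sg ->]]; first by exists f.
  exists (fun x => 'D_v g x + l v * g x).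
    by apply: smoothD; [exact: smooth_derive|exact: smoothZ].
  apply/funext => x.
  by have [_ ->] := is_derive_mul (de x v) (smooth_is_derive x v sg); ring.
split => [|x v]; first by apply: continuous_mul => //; exact: smooth_continuous.
by have [] := is_derive_mul (de x v) (smooth_is_derive x v sg).
Qed.

Lemma iter_derive_off_support f vs x : ~ closure [set x | f x != 0] x ->
  iter_derive f vs x = 0.
Proof.
set K := closure _ => nKx.
(* A neighbourhood is needed for the induction: vanishing at x alone says nothing about the next
   derivative. *)
have : \forall y \near x, iter_derive f vs y = 0; last exact: nbhs_singleton.
elim: vs => /= [|v vs IH].
  have oK : open (~` K) by apply: closed_openC; exact: closed_closure.
  have := open_nbhs_nbhs (conj oK nKx); apply: filterS => y nKy.
  by apply/eqP; apply: contra_notT nKy => fy; exact: subset_closure.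
have := nbhs_interior IH; apply: filterS => y Hy.
have -> : 'D_v (iter_derive f vs) y = 'D_v (cst (0 : R)) y.
  by apply: near_eq_derive.
by rewrite derive_cst.
Qed.

Lemma test_function_off D f vs x : test_function D f -> ~ D x -> iter_derive f vs x = 0.
Proof. by move=> [_ _ KD] nDx; apply: iter_derive_off_support => /KD. Qed.

Lemma test_function_bounded D f : test_function D f -> forall vs,
  exists M, forall x, `|iter_derive f vs x| <= M.
Proof.
move=> [sf cK _] vs; set K := closure _ in cK.
have [cf _] := sf vs.
have : compact ((iter_derive f vs) @` K).
  by apply: continuous_compact => //; exact: continuous_subspaceT.
move=> /compact_bounded[M [_ HM]].
exists (Num.max (M + 1) 0) => x.
have [Kx|nKx] := pselect (K x).
  by rewrite le_max (HM (M + 1)) ?ltrDl//; exists x.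
by rewrite iter_derive_off_support// normr0 le_max lexx orbT.
Qed.

End smooth_functions.

(** * Smooth functions of one variable and the flat exponential *)

Section functions_of_class_Ck.
Context (R : realType).
Implicit Types f g : R -> R.

(** [smooth] quantifies over all iterated directional derivatives; exhibiting one derivative at a
    time makes closure under products and compositions an induction on n. *)
Fixpoint Ck n f := if n is m.+1 then
    exists2 df, (forall x : R, is_derive x (1 : R) f (df x)) & Ck m df
  else continuous f.

Definition Coo f := forall n, Ck n f.

Lemma is_derive_continuous f (df : R -> R) :
  (forall x : R, is_derive x (1 : R) f (df x)) -> continuous f.
Proof.
by move=> d x; apply/differentiable_continuous/derivable1_diffP; exact: ex_derive.
Qed.

Lemma CkS n f : Ck n.+1 f -> Ck n f.
Proof.
elim: n f => [|n IH] f [df d cdf]; first exact: is_derive_continuous d.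
by exists df => //; exact: IH.
Qed.

Lemma CkD n f g : Ck n f -> Ck n g -> Ck n (fun x => f x + g x).
Proof.
elim: n f g => [|n IH] f g; first exact: continuous_add.
move=> [df d cf] [dg e cg]; exists (fun x => df x + dg x); last exact: IH.
by move=> x; exact: is_derive_add.
Qed.

Lemma CkM n f g : Ck n f -> Ck n g -> Ck n (fun x => f x * g x).
Proof.
elim: n f g => [|n IH] f g; first exact: continuous_mul.
move=> cf1 cg1; have cf' := CkS cf1; have cg' := CkS cg1.
case: cf1 => df d cf; case: cg1 => dg e cg.
exists (fun x => f x * dg x + g x * df x); last by apply: CkD; exact: IH.
by move=> x; exact: is_derive_mul.
Qed.

Lemma Ck_cst n (k : R) : Ck n (fun _ => k).
Proof.
elim: n k => [|n IH] k; first by move=> x; exact: cvg_cst.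
by exists (fun=> 0) => // x; exact: is_derive_cst.
Qed.

Lemma Ck_id n : Ck n (fun x : R => x).
Proof.
case: n => [|n]; first by move=> x; exact: cvg_id.
by exists (fun=> 1); [move=> x; exact: is_derive_id|exact: Ck_cst].
Qed.

Lemma Ck_comp n f g : Ck n f -> Ck n g -> Ck n (fun x => f (g x)).
Proof.
elim: n f g => [|n IH] f g.
  by move=> cf cg x; apply: (@continuous_comp _ _ _ g f); [exact: cg|exact: cf].
move=> [df d cf] cg1; have cg' := CkS cg1; case: cg1 => dg e cg.
exists (fun x => df (g x) * dg x); last by apply: CkM => //; exact: IH.
by move=> x; exact: is_derive1_comp.
Qed.

Lemma Ck_sin n : Ck n (@sin R) /\ Ck n (@cos R).
Proof.
elim: n => [|n [IHs IHc]]; first by split; [exact: continuous_sin|exact: continuous_cos].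
split; first by exists (@cos R) => // x; exact: is_derive_sin.
exists (fun x => -1 * sin x); last by apply: CkM => //; exact: Ck_cst.
by move=> x; rewrite mulN1r; exact: is_derive_cos.
Qed.

Lemma Coo_smooth f : Coo f -> @smooth R R f.
Proof.
move=> cf vs.
have : Coo (@iter_derive R R f vs).
  elim: vs => //= v vs IH n.
  have [df d cdf] := IH n.+1.
  have -> : 'D_v (@iter_derive R R f vs) = fun x => v * df x.
    apply/funext => x; rewrite deriveE; last first.
      by apply/derivable1_diffP; have [] := d x.
    rewrite -[X in 'd _ _ X]mulr1 [LHS]linearZ /=; congr (_ * _).
    by rewrite -deriveE; [have [] := d x|apply/derivable1_diffP; have [] := d x].
  by apply: CkM => //; exact: Ck_cst.
move=> H; split; first exact: (H 0%N).
move=> x v; have [df d _] := H 1%N.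
by apply: diff_derivable; apply/derivable1_diffP; have [] := d x.
Qed.

(* z^-k e^(-1/z), extended by 0: closed under differentiation up to linear combinations. *)
Definition flat k (z : R) : R := if 0 < z then z ^- k * expR (- z^-1) else 0.

(** The exponential of 1/z dominates a single term of its series, one degree above the power to be
    absorbed. The spare factor z gives differentiability at 0. *)
Lemma flat_bound k (z : R) : 0 < z -> z ^- k * expR (- z^-1) <= k.+1`!%:R * z.
Proof.
move=> z0; have zi0 : 0 <= z^-1 by rewrite invr_ge0 ltW.
have := expR_ge1Dxn k zi0; rewrite expRN => H.
rewrite ler_pdivrMr ?expR_gt0//.
have F : 0 < (k.+1`!%:R : R) by rewrite ltr0n fact_gt0.
have H1 : z^-1 ^+ k.+1 <= k.+1`!%:R * expR z^-1.
  by rewrite mulrC -ler_pdivrMr// (le_trans _ H)// lerDr.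
rewrite mulrAC -ler_pdivrMr//; apply: le_trans H1.
by rewrite exprVn exprSr invfM.
Qed.

Lemma flat_ge0 k z : 0 <= flat k z.
Proof.
rewrite /flat; case: ifPn => // z0.
by rewrite mulr_ge0 ?expR_ge0// invr_ge0 exprn_ge0// ltW.
Qed.

Lemma is_derive_flat k (z : R) : is_derive z (1 : R) (flat k) (flat k.+2 z - k%:R * flat k.+1 z).
Proof.
have [z0|z0|<-] := ltgtP 0 z.
- have [|] := boolP (z == 0); first by rewrite gt_eqF.
  move=> zn0.
  apply: (@near_eq_is_derive _ _ _ (fun y : R => y ^- k * expR (- y^-1))).
    near=> y; rewrite /flat ifT//.
    by near: y; exact: lt_nbhsr.
  have d1 : is_derive z (1 : R) (fun y : R => - y^-1) (z ^- 2).
    apply: (is_derive_eq (is_deriveN (is_deriveV zn0 (is_derive_id z (1:R))))).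
    by rewrite scaleNr opprK [_%:A]mulr1.
  have d2 := @is_derive1_comp _ expR (fun y => - y^-1) _ _ _ (is_derive_expR (- z^-1)) d1.
  have zk0 : z ^+ k != 0 by rewrite expf_neq0.
  have d3 : is_derive z (1 : R) (fun y : R => y ^+ k) (k%:R * z ^+ k.-1).
    by split; [exact: exprn_derivable|rewrite exp_derive [_ *: 1]mulr1].
  have d4 := @is_deriveV _ (fun y : R => y ^+ k) z _ _ zk0 d3.
  apply: (is_derive_eq (is_derive_mul d4 d2)).
  rewrite /flat z0 /=; case: k zk0 {d3 d4} => [|k] zk0.
    by rewrite /GRing.scale /= !expr0; field; rewrite ?zn0 ?expr0 ?oner_eq0.
  rewrite /GRing.scale /= !exprS; field.
  by move: zk0; rewrite exprS mulf_eq0 negb_or zn0 => /= ->.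
- have -> : flat k.+2 z - k%:R * flat k.+1 z = 0.
    by rewrite /flat !ifF ?mulr0 ?subrr//; apply/negbTE; rewrite -leNgt ltW.
  apply: (@near_eq_is_derive _ _ _ (cst (0 : R))).
  near=> y; rewrite /flat ifF//; apply/negbTE; rewrite -leNgt ltW//.
  by near: y; exact: lt_nbhsl.
- have f0 j : flat j 0 = 0 by rewrite /flat ltxx.
  rewrite !f0 mulr0 subrr.
  suff : (fun h : R => h^-1 *: ((flat k \o shift 0) (h *: (1:R)) - flat k 0)) @ 0^' --> (0 : R).
    move=> H; split; first by apply/cvg_ex; exists 0.
    exact: cvg_lim H.
  rewrite f0; apply: norm_cvg0.
  apply: (@squeeze_cvgr _ _ _ _ (cst 0) (fun h : R => k.+2`!%:R * `|h|)).
  + near=> h; rewrite normr_ge0 /= addr0 subr0 [_%:A]mulr1.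
    change (`|h^-1 * flat k h| <= k.+2`!%:R * `|h|).
    rewrite /flat; case: ifPn => h0; last by rewrite mulr0 normr0 mulr_ge0.
    (* For h > 0 the difference quotient of [flat k] at 0 is [flat k.+1 h], which is O(h). *)
    have := flat_bound k.+1 h0; rewrite exprS invfM -mulrA => H.
    rewrite ger0_norm ?(gtr0_norm h0)//.
    by rewrite !mulr_ge0 ?expR_ge0 ?invr_ge0 ?exprn_ge0 ?ltW.
  + exact: cvg_cst.
  + rewrite -[X in _ --> X](mulr0 (k.+2`!%:R)); apply: cvgM; first exact: cvg_cst.
    have H : `|h : R| @[h --> (0 : R)] --> (0 : R).
      by rewrite -[X in _ --> X](normr0 R); exact: norm_continuous.
    by apply: cvg_trans H; apply: cvg_app; exact: cvg_within.
Unshelve. all: by end_near. Qed.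

Lemma Ck_flat n k : Ck n (flat k).
Proof.
elim: n k => [|n IH] k; first exact: is_derive_continuous (is_derive_flat k).
exists (fun z => flat k.+2 z + - k%:R * flat k.+1 z).
  by move=> x; rewrite mulNr; exact: is_derive_flat.
by apply: CkD => //; apply: CkM => //; exact: Ck_cst.
Qed.

End functions_of_class_Ck.

(** * The sharp Poincare inequality and a sup bound in one dimension *)

Section calculus_on_a_segment.
Context (R : realType).
Notation mu := (@lebesgue_measure R).
Implicit Types (f F : R -> R) (a b x y : R).

Lemma within_segment_continuous f a b :
  (forall x, x \in `[a, b] -> {for x, continuous f}) -> {within `[a, b], continuous f}.
Proof. by move=> cf; apply: continuous_in_subspaceT => x /set_mem; exact: cf. Qed.

Lemma segment_integrable f a b :
  (forall x, x \in `[a, b] -> {for x, continuous f}) ->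
  mu.-integrable `[a, b] (EFin \o f).
Proof.
move=> cf; apply: continuous_compact_integrable; first exact: segment_compact.
exact: within_segment_continuous.
Qed.

Lemma Rint_derive F f a b : a < b ->
  (forall x, x \in `[a, b] -> is_derive x (1 : R) F (f x)) ->
  (forall x, x \in `[a, b] -> {for x, continuous f}) ->
  \int[mu]_(x in `[a, b]) f x = F b - F a.
Proof.
move=> ab dF cf.
have cF x : x \in `[a, b] -> {for x, continuous F}.
  by move=> /dF[dFx _]; apply/differentiable_continuous/derivable1_diffP.
rewrite /Rintegral (@continuous_FTC2 _ f F a b)//.
- exact: within_segment_continuous.
- split.
  + move=> x; rewrite in_itv /= => /andP[ax xb].
    by have [] := dF x; rewrite // in_itv /= !ltW.
  + by apply: cvg_at_right_filter; apply: cF; rewrite in_itv /= lexx ltW.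
  + by apply: cvg_at_left_filter; apply: cF; rewrite in_itv /= lexx ltW.
- move=> x; rewrite in_itv /= => /andP[ax xb].
  by have [] := dF x; rewrite ?derive1E// in_itv /= !ltW.
Qed.

(* With c = s'/s for a positive solution s of s'' = - k^2 s one has
   (f' - f c)^2 = f'^2 - k^2 f^2 - (f^2 c)'. *)
Lemma poincare_wider f df a b t : a < b -> b - a < t ->
  (forall x, is_derive x (1 : R) f (df x)) -> continuous df ->
  f a = 0 -> f b = 0 ->
  (pi / t) ^+ 2 * \int[mu]_(x in `[a, b]) (f x ^+ 2) <=
  \int[mu]_(x in `[a, b]) (df x ^+ 2).
Proof.
move=> ab tab dfx cdf fa fb.
have t0 : 0 < t by lra.
set k := pi / t; have k0 : 0 < k by rewrite divr_gt0 ?pi_gt0.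
(* The phase centres [a, b] in an interval of length t > b - a, so that the sine has no zero on the
   closed segment and c is continuous up to the endpoints. *)
pose g x := k * (x - a) + k * ((t - (b - a)) / 2).
pose s x := sin (g x); pose c x := k * cos (g x) / s x.
have s0 x : x \in `[a, b] -> s x != 0.
  rewrite in_itv /= => /andP[ax xb]; rewrite gt_eqF// sin_gt0_pi//.
  have -> : pi = k * t :> R by rewrite /k divfK// gt_eqF.
  rewrite /g -mulrDr mulr_gt0//=; last by lra.
  by rewrite ltr_pM2l//; lra.
have dg x : is_derive x (1 : R) g k.
  apply: (is_derive_eq (is_derive_add (is_derive_scale k (is_derive_add
    (is_derive_id x (1 : R)) (is_derive_cst (- a) x (1 : R)))) (is_derive_cst _ x (1 : R)))).
  by rewrite !addr0 mulr1.
have ds x : is_derive x (1 : R) s (k * cos (g x)).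
  by rewrite mulrC; exact: (@is_derive1_comp _ (@sin R) g _ _ _ (is_derive_sin _) (dg x)).
have dc0 x : is_derive x (1 : R) (fun y => cos (g y)) (- sin (g x) * k).
  exact: (@is_derive1_comp _ (@cos R) g _ _ _ (is_derive_cos _) (dg x)).
(* The Riccati equation of the logarithmic derivative. *)
have dc x : x \in `[a, b] -> is_derive x (1 : R) c (- (k ^+ 2 + c x ^+ 2)).
  move=> xab; have sx := s0 x xab.
  have dv := @is_deriveV _ s x _ _ sx (ds x).
  apply: (is_derive_eq (is_derive_mul (is_derive_scale k (dc0 x)) dv)).
  by rewrite /GRing.scale /= /c /s; field; exact: sx.
pose H x := f x ^+ 2 * c x.
pose h x := 2 * f x * df x * c x - f x ^+ 2 * (k ^+ 2 + c x ^+ 2).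
have dH x : x \in `[a, b] -> is_derive x (1 : R) H (h x).
  move=> xab; have := is_derive_mul (is_derive_mul (dfx x) (dfx x)) (dc x xab).
  rewrite (_ : (fun y => _) = H); last by apply/funext => y; rewrite /H expr2.
  by move=> D; apply: (is_derive_eq D); rewrite /h; ring.
have cf : continuous f := is_derive_continuous dfx.
have cc x : x \in `[a, b] -> {for x, continuous c}.
  by move=> /dc[dcx _]; apply/differentiable_continuous/derivable1_diffP.
have ch x : x \in `[a, b] -> {for x, continuous h}.
  move=> xab; have cx := cc x xab; have fx := cf x; have dx := cdf x.
  have c2 : {for x, continuous (fun y => c y ^+ 2)} by apply: continuousM.
  have f2 : {for x, continuous (fun y => f y ^+ 2)} by apply: continuousM.
  apply: continuousB.
    by do 2 (apply: continuousM => //); apply: continuousM => //; exact: cvg_cst.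
  by apply: continuousM => //; apply: continuousD => //; exact: cvg_cst.
have := @Rint_derive H h a b ab dH ch; rewrite /H fa fb expr0n /= !mul0r subrr => Ih.
have if2 : mu.-integrable `[a, b] (EFin \o (fun x => f x ^+ 2)).
  by apply: segment_integrable => x _; apply: continuousM; exact: cf.
have idf2 : mu.-integrable `[a, b] (EFin \o (fun x => df x ^+ 2)).
  by apply: segment_integrable => x _; apply: continuousM; exact: cdf.
have ikf2 : mu.-integrable `[a, b] (EFin \o (fun x => k ^+ 2 * f x ^+ 2)).
  apply: segment_integrable => x _; apply: continuousM; first exact: cvg_cst.
  by apply: continuousM; exact: cf.
rewrite -RintegralZl// -subr_ge0 -RintegralB// -Ih.
apply: le_Rintegral => //; first exact: segment_integrable.
  apply: segment_integrable => x _; apply: continuousB; first by apply: continuousM; exact: cdf.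
  by apply: continuousM; [exact: cvg_cst|apply: continuousM; exact: cf].
by move=> x _; rewrite /h; have := sqr_ge0 (df x - f x * c x); lra.
Qed.

Lemma poincare_segment f df a b : a < b ->
  (forall x, is_derive x (1 : R) f (df x)) -> continuous df ->
  f a = 0 -> f b = 0 ->
  (pi / (b - a)) ^+ 2 * \int[mu]_(x in `[a, b]) (f x ^+ 2) <=
  \int[mu]_(x in `[a, b]) (df x ^+ 2).
Proof.
move=> ab dfx cdf fa fb.
set X := \int[mu]_(x in _) _; set Y := \int[mu]_(x in _) (df _ ^+ 2).
have l0 : 0 < b - a by lra.
have Y0 : 0 <= Y by apply: Rintegral_ge0 => x _; exact: sqr_ge0.
rewrite exprMn exprVn mulrAC ler_pdivrMr ?exprn_gt0//.
apply/ler_addgt0Pr => e e0.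
(* For h <= 1 the square of b - a + h exceeds that of b - a by at most h (2 (b - a) + 1); the last 1
   in the denominator covers Y = 0. *)
pose h := Num.min 1 (e / (Y * (2 * (b - a) + 1) + 1)).
have D0 : 0 < Y * (2 * (b - a) + 1) + 1 by nra.
have h0 : 0 < h by rewrite lt_min ltr01 divr_gt0.
have h1 : h <= 1 by rewrite ge_min lexx.
have he : h * (Y * (2 * (b - a) + 1) + 1) <= e by rewrite -ler_pdivlMr// ge_min lexx orbT.
have := @poincare_wider f df a b (b - a + h) ab _ dfx cdf fa fb.
have th : 0 < b - a + h by lra.
rewrite ltrDl => /(_ h0); rewrite exprMn exprVn mulrAC ler_pdivrMr ?exprn_gt0//.
move=> H; apply: le_trans H _; rewrite -/Y.
have : Y * h * h <= Y * h by rewrite ler_piMr ?mulr_ge0// ltW.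
nra.
Qed.

Lemma poincare_line f df a b : a < b ->
  (forall x, is_derive x (1 : R) f (df x)) -> continuous df ->
  (forall x, ~ (`]a, b[%classic) x -> f x = 0) ->
  (((pi / (b - a)) ^+ 2)%:E * \int[mu]_x (f x ^+ 2)%:E <= \int[mu]_x (df x ^+ 2)%:E)%E.
Proof.
move=> ab dfx cdf f0; have cf := is_derive_continuous dfx.
have fa : f a = 0 by apply: f0; rewrite /= in_itv /= ltxx.
have fb : f b = 0 by apply: f0; rewrite /= in_itv /= ltxx andbF.
have if2 : mu.-integrable `[a, b] (EFin \o (fun x => f x ^+ 2)).
  by apply: segment_integrable => x _; apply: continuousM; exact: cf.
have idf2 : mu.-integrable `[a, b] (EFin \o (fun x => df x ^+ 2)).
  by apply: segment_integrable => x _; apply: continuousM; exact: cdf.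
have -> : (\int[mu]_x (f x ^+ 2)%:E = \int[mu]_(x in `[a, b]) (f x ^+ 2)%:E)%E.
  rewrite [RHS]integral_mkcond; apply: eq_integral => x _; rewrite patchE.
  case: ifPn => // /negP; rewrite inE => nx; rewrite f0 ?expr0n// => x'; apply: nx.
  by move: x'; rewrite /= !in_itv /= => /andP[? ?]; rewrite !ltW.
apply: (@le_trans _ _ (\int[mu]_(x in `[a, b]) (df x ^+ 2)%:E)%E).
  have := poincare_segment ab dfx cdf fa fb.
  rewrite /Rintegral -lee_fin EFinM !fineK//; exact: integrable_fin_num.
apply: ge0_subset_integral => //.
- apply/measurable_EFinP; apply: continuous_measurable_fun => x.
  by apply: continuousM; exact: cdf.
- by move=> x _; rewrite lee_fin sqr_ge0.
Qed.

(** f(x) is the integral of f' up to x and minus the integral of f' from x on. Using both halves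
    gives the factor 2, whose square is the 4 in the bound of ||f||_2^2 by the two L^1 norms. *)
Lemma le_half_int_derive f df a b : a < b ->
  (forall x, is_derive x (1 : R) f (df x)) -> continuous df ->
  (forall x, ~ (`]a, b[%classic) x -> f x = 0) ->
  forall x, ((2 * `|f x|)%:E <= \int[mu]_y `|df y|%:E)%E.
Proof.
move=> ab dfx cdf f0 x.
have [xab|nx] := pselect (`]a, b[%classic x); last first.
  rewrite f0// normr0 mulr0; by apply: integral_ge0 => y _; rewrite lee_fin.
move: (xab); rewrite /= in_itv /= => /andP[ax xb].
have fa : f a = 0 by apply: f0; rewrite /= in_itv /= ltxx.
have fb : f b = 0 by apply: f0; rewrite /= in_itv /= ltxx andbF.
have mdf : measurable_fun setT (fun y => `|df y|%:E).
  apply/measurable_EFinP/measurableT_comp => //.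
  exact: continuous_measurable_fun.
have H c d : c < d -> (`|f d - f c|%:E <= \int[mu]_(y in `[c, d]) `|df y|%:E)%E.
  move=> cd; rewrite -(@Rint_derive f df c d cd)//; last by move=> y _; exact: cdf.
  have I : mu.-integrable `[c, d] (EFin \o df).
    by apply: segment_integrable => y _; exact: cdf.
  have : `|\int[mu]_(y in `[c, d]) df y| <= \int[mu]_(y in `[c, d]) `|df y|.
    exact: le_normr_Rintegral.
  rewrite -lee_fin => /le_trans; apply.
  rewrite /Rintegral fineK//; apply: integrable_fin_num => //.
  exact: (integrable_norm I).
rewrite [leRHS](_ : _ =
    \int[mu]_(y in `]-oo, x]) `|df y|%:E + \int[mu]_(y in ~` `]-oo, x]) `|df y|%:E)%E; last first.
  rewrite -ge0_integral_setU ?setUv//; last exact/disj_setPCl.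
  exact: measurableC.
rewrite mulr_natl mulr2n EFinD; apply: leeD.
- have := H a x ax; rewrite fa subr0 => /le_trans; apply.
  apply: ge0_subset_integral => //; first exact: measurable_funTS.
  by apply: subset_itvr.
- have := H x b xb; rewrite fb sub0r normrN => /le_trans; apply.
  rewrite -integral_itv_obnd_cbnd; last exact: measurable_funTS.
  apply: ge0_subset_integral => //; [exact: measurableC|exact: measurable_funTS|].
  by move=> y; rewrite /= !in_itv /= => /andP[xy _]; apply/negP; rewrite -ltNge.
Qed.

End calculus_on_a_segment.

(** * Bounded pointwise convergence implies L^2 convergence *)

Section bounded_convergence.
Context (R : realType) (d : measure_display) (T : measurableType d).
Variables (mu : {measure set T -> \bar R}) (D : set T).
Hypothesis mD : measurable D.

Lemma L2_cvg_cst (f : T -> R) : L2_cvg mu D (fun=> f) f.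
Proof.
rewrite /L2_cvg; under eq_fun do under eq_integral do rewrite subrr expr0n/=.
by under eq_fun do rewrite integral0; exact: cvg_cst.
Qed.

Lemma L2_cvg_bounded (f_ : nat -> T -> R) (f : T -> R) M : (mu D < +oo)%E ->
  (forall k, measurable_fun D (f_ k)) -> measurable_fun D f ->
  (forall k x, D x -> `|f_ k x - f x| <= M) ->
  (forall x, D x -> f_ k x @[k --> \oo] --> f x) -> L2_cvg mu D f_ f.
Proof.
move=> Doo mf_ mf fM ff.
have [] := @dominated_convergence _ _ _ mu _ mD
  (fun k x => ((f_ k x - f x) ^+ 2)%:E) (fun=> 0%E) (fun=> (M ^+ 2)%:E).
- by move=> k; apply/measurable_EFinP/measurable_funX/measurable_funB.
- exact: measurable_cst.
- apply: aeW => x Dx; apply: cvg_EFin; first exact: nearW.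
  rewrite [X in _ --> X](_ : _ = (0 : R) * 0); last by rewrite mulr0.
  by apply: cvgM; apply/subr_cvg0; exact: ff.
- apply/integrableP; split; first exact: measurable_cst.
  by rewrite integral_cst// lte_mul_pinfty.
- apply: aeW => x k Dx; rewrite lee_fin ger0_norm ?sqr_ge0//.
  rewrite -(real_normK (num_real (f_ k x - f x))) lerXn2r ?nnegrE//; last exact: fM.
  exact: le_trans (fM k _ Dx).
- by move=> _ _; rewrite integral0.
Qed.

End bounded_convergence.

(** * The sine as a Dirichlet eigenfunction of an interval *)

Section upper_bound_of_mu1.
Context (R : realType).
Notation mu := (@lebesgue_measure R).
Variables (a b : R).
Hypothesis ab : a < b.

Let k := pi / (b - a).
Let D : set R := `]a, b[.
Let s (x : R) : R := sin (k * (x - a)).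
Let c (x : R) : R := cos (k * (x - a)).
(** A polynomial substitute for the distance to the boundary: positive exactly on ]a, b[, and
    cutoffs built from it are smooth. *)
Let p (x : R) : R := (x - a) * (b - x).
Let dp (x : R) : R := a + b - 2 * x.

Let l0 : 0 < b - a. Proof. by rewrite subr_gt0. Qed.

Let k0 : 0 < k. Proof. by rewrite divr_gt0 ?pi_gt0. Qed.

Lemma sin_le_id (x : R) : 0 <= x -> sin x <= x.
Proof.
move=> x0.
have [y _] := @MVT_segment R (@sin R) (@cos R) 0 x x0 (fun y _ => is_derive_sin y)
  (continuous_subspaceT (@continuous_sin R)).
by rewrite sin0 !subr0 => ->; rewrite ler_piMl// cos_le1.
Qed.

Let s_pos x : D x -> 0 < s x.
Proof.
rewrite /D /= in_itv /= => /andP[ax xb]; apply: sin_gt0_pi.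
have -> : pi = k * (b - a) :> R by rewrite /k divfK// gt_eqF.
by rewrite mulr_gt0 ?subr_gt0//= ltr_pM2l// ltrD2r.
Qed.

Let p_pos x : 0 < p x -> D x.
Proof.
rewrite /D /p /= in_itv /= => H; have [xa|ax] := leP x a.
  have Hn : (x - a) * (b - x) <= 0.
    by rewrite mulr_le0_ge0// ?subr_le0// subr_ge0 (le_trans xa)// ltW.
  by move: H; rewrite ltNge Hn.
have [//|bx] := ltP x b; move: H; apply: contraTT => _.
by rewrite -leNgt mulr_ge0_le0//; lra.
Qed.

Let D_p x : D x -> 0 < p x.
Proof. by rewrite /D /= in_itv /= => /andP[ax xb]; rewrite mulr_gt0 ?subr_gt0. Qed.

(** The derivative of the cutoff carries a factor n; this bound absorbs it by turning n s into a
    multiple of n p = q n + 1. It is sin t <= t measured from either endpoint, weighted by the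
    distance to the other one. *)
Let s_le_p x : D x -> s x * (b - a) <= 2 * k * p x.
Proof.
move=> Dx; move: (Dx); rewrite /D /= in_itv /= => /andP[ax xb].
have H1 : s x <= k * (x - a) by apply: sin_le_id; rewrite mulr_ge0 ?ltW// subr_gt0.
have H2 : s x <= k * (b - x).
  have -> : s x = sin (k * (b - x)).
    have -> : k * (b - x) = - (k * (x - a)) + pi.
      have -> : pi = k * (b - a) :> R by rewrite /k divfK// gt_eqF.
      ring.
    by rewrite sinDpi sinN opprK.
  by apply: sin_le_id; rewrite mulr_ge0 ?ltW// subr_gt0.
have u0 : 0 < x - a by lra. have v0 : 0 < b - x by lra.
rewrite /p (_ : b - a = (x - a) + (b - x)); last by ring.
rewrite mulrDr; have := ler_wpM2r (ltW u0) H2; have := ler_wpM2r (ltW v0) H1; lra.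
Qed.

Let ds x : is_derive x (1 : R) s (k * c x).
Proof.
have dg : is_derive x (1 : R) (fun y => k * (y - a)) k.
  apply: (is_derive_eq (is_derive_scale k (is_derive_add (is_derive_id x (1 : R))
    (is_derive_cst (- a) x (1 : R))))).
  by rewrite addr0 mulr1.
by rewrite mulrC; exact: (@is_derive1_comp _ (@sin R) _ _ _ _ (is_derive_sin _) dg).
Qed.

Let dc x : is_derive x (1 : R) c (- k * s x).
Proof.
have dg : is_derive x (1 : R) (fun y => k * (y - a)) k.
  apply: (is_derive_eq (is_derive_scale k (is_derive_add (is_derive_id x (1 : R))
    (is_derive_cst (- a) x (1 : R))))).
  by rewrite addr0 mulr1.
rewrite mulNr mulrC -mulNr.
exact: (@is_derive1_comp _ (@cos R) _ _ _ _ (is_derive_cos _) dg).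
Qed.

Let cs : continuous s := is_derive_continuous ds.
Let cc : continuous c := is_derive_continuous dc.

Let q n x : R := n%:R * p x + -1.

(* The support of phi n lies in {n p >= 1}, a compact subset of ]a, b[. *)
Let phi n x := s x * flat 0 (q n x).
Let dphi n x := k * c x * flat 0 (q n x) + s x * (n%:R * dp x) * flat 2 (q n x).

Let dphiE n x : is_derive x (1 : R) (phi n) (dphi n x).
Proof.
have dp1 : is_derive x (1 : R) p (dp x).
  have := is_derive_mul (is_derive_add (is_derive_id x (1 : R)) (is_derive_cst (- a) x (1 : R)))
    (is_derive_add (is_derive_cst b x (1 : R)) (is_deriveNid x (1 : R))).
  by move=> H; apply: (is_derive_eq H); rewrite /dp /= /cst; ring.
have dq : is_derive x (1 : R) (q n) (n%:R * dp x).
  have := is_derive_add (is_derive_scale n%:R dp1) (is_derive_cst (-1 : R) x (1 : R)).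
  by move=> H; apply: (is_derive_eq H); rewrite addr0.
have df := @is_derive1_comp _ (flat 0) (q n) _ _ _ (is_derive_flat 0 (q n x)) dq.
apply: (is_derive_eq (is_derive_mul (ds x) df)).
by rewrite /dphi /= mul0r subr0; ring.
Qed.

Let Coo_phi n : Coo (phi n).
Proof.
move=> m; apply: CkM.
  apply: (@Ck_comp _ m (@sin R)); first by have [] := Ck_sin R m.
  by apply: CkM; [exact: Ck_cst|apply: CkD; [exact: Ck_id|exact: Ck_cst]].
apply: (@Ck_comp _ m (flat 0)); first exact: Ck_flat.
apply: CkD; last exact: Ck_cst.
apply: CkM; first exact: Ck_cst.
apply: CkM; first by apply: CkD; [exact: Ck_id|exact: Ck_cst].
apply: CkD; first exact: Ck_cst.
have -> : -%R = (fun x : R => -1 * x) by apply/funext => x; rewrite mulN1r.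
by apply: CkM; [exact: Ck_cst|exact: Ck_id].
Qed.

Let phi_test n : @test1 R D (phi n).
Proof.
have cp : continuous (fun x => n%:R * p x).
  apply: continuous_mul; first by move=> x; exact: cvg_cst.
  apply: continuous_mul; first by apply: continuous_add => x; [exact: cvg_id|exact: cvg_cst].
  by move=> x; apply: cvgB; [exact: cvg_cst|exact: cvg_id].
pose K := (fun x => n%:R * p x) @^-1` [set y | 1 <= y].
have cK : closed K by apply: preimage_closed; [move=> x _; exact: cp|exact: closed_ge].
have KD : K `<=` D.
  move=> x Kx; apply: p_pos; have : 0 < n%:R * p x by rewrite (lt_le_trans _ Kx).
  by have [-> |n0] := posnP n; rewrite ?mul0r ?ltxx// pmulr_rgt0 ?ltr0n.
have sK : closure [set x | phi n x != 0] `<=` K.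
  have /closure_id KE := cK.
  rewrite [X in _ `<=` X]KE; apply: closure_subset => x /=.
  rewrite /K /= /phi /flat /q; case: ifPn; first by move=> + _; lra.
  by rewrite mulr0 eqxx.
split.
- exact/Coo_smooth/Coo_phi.
- apply: (@subclosed_compact _ _ `[a, b]); first exact: closed_closure.
    exact: segment_compact.
  by move=> x /sK/KD; rewrite /D /= !in_itv /= => /andP[? ?]; rewrite !ltW.
- exact: subset_trans KD.
Qed.

Let flat0_bounds (z : R) : 0 < z -> 0 <= 1 - flat 0 z <= z^-1.
Proof.
move=> z0; rewrite /flat z0 expr0 invr1 mul1r.
have := expR_ge1Dx (- z^-1).
have : expR (- z^-1) <= 1 by rewrite expR_le1 oppr_le0 invr_ge0 ltW.
lra.
Qed.

Let flat0_01 (z : R) : 0 <= flat 0 z <= 1.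
Proof.
rewrite flat_ge0 /flat; case: ifPn => z0; last by rewrite ler01.
by rewrite expr0 invr1 mul1r expR_le1 oppr_le0 invr_ge0 ltW.
Qed.

(** With t = 1/z the product is (t + t^2) e^(-t). The first bound gives pointwise convergence of
    [dphi], the second its domination; 3 comes from t <= e^t - 1 and t^2 <= 2 (e^t - 1). *)
Let flat2_bounds (z : R) : 0 < z -> (z + 1) * flat 2 z <= z^-1 + z^-1 ^+ 2 /\ (z + 1) * flat 2 z <= 3.
Proof.
move=> z0; set t := z^-1.
have t0 : 0 < t by rewrite invr_gt0.
have -> : (z + 1) * flat 2 z = (t + t ^+ 2) * expR (- t).
  by rewrite /flat z0 /t; field; rewrite gt_eqF.
have E1 : expR (- t) <= 1 by rewrite expR_le1 oppr_le0 ltW.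
split; first by rewrite ler_piMr// addr_ge0 ?sqr_ge0// ltW.
rewrite expRN ler_pdivrMr ?expR_gt0//.
have := expR_ge1Dxn 1 (ltW t0); have := expR_ge1Dx t.
by rewrite (_ : 2`!%:R = 2 :> R)//; lra.
Qed.

Let q_cvg x : D x -> (q n x)^-1 @[n --> \oo] --> (0 : R).
Proof.
move=> Dx; have p0 := D_p Dx.
have qA A : \forall n \near \oo, A <= q n x.
  have := nbhs_infty_ger ((A + 1) / p x); apply: filterS => n.
  by rewrite ler_pdivrMr// /q => H; lra.
apply/gtr0_cvgV0.
  by have := qA 1; apply: filterS => n; lra.
by apply/cvgryPge => A; exact: qA.
Qed.

Let q_pos x : D x -> \forall n \near \oo, 0 < q n x.
Proof.
move=> Dx; have p0 := D_p Dx.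
have := nbhs_infty_ger (2 / p x); apply: filterS => n.
by rewrite ler_pdivrMr// /q => H; lra.
Qed.

Let s1 x : `|s x| <= 1. Proof. exact: sin_max. Qed.
Let c1 x : `|c x| <= 1. Proof. exact: cos_max. Qed.

Let phi_le n x : `|phi n x - s x| <= 1 - flat 0 (q n x).
Proof.
have /andP[f0 f1] := flat0_01 (q n x).
rewrite /phi (_ : _ - _ = - (s x * (1 - flat 0 (q n x)))); last by ring.
by rewrite normrN normrM (ger0_norm (_ : 0 <= 1 - _)) ?subr_ge0// ler_piMl// subr_ge0.
Qed.

Let dphi_le n x : D x -> 0 < q n x ->
  `|dphi n x - k * c x| <= k * (1 - flat 0 (q n x)) + 2 * k * ((q n x + 1) * flat 2 (q n x)).
Proof.
move=> Dx q0; have p0 := D_p Dx; have sx := s_pos Dx.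
have /andP[f0 f1] := flat0_01 (q n x).
rewrite /dphi (_ : _ - _ = - (k * c x * (1 - flat 0 (q n x))) +
  s x * (n%:R * dp x) * flat 2 (q n x)); last by ring.
apply: le_trans (ler_normD _ _) _; apply: lerD.
  rewrite normrN 2!normrM (ger0_norm (ltW k0)) (ger0_norm (_ : 0 <= 1 - _)) ?subr_ge0//.
  by rewrite -mulrA ler_pM2l// ler_piMl// subr_ge0.
rewrite 3!normrM (ger0_norm (flat_ge0 _ _)) [leRHS]mulrA ler_wpM2r ?flat_ge0//.
rewrite (ger0_norm (ltW sx)) (ger0_norm (ler0n _ _)) /q subrK.
have dpl : `|dp x| <= b - a.
  by move: Dx; rewrite /D /= in_itv /= ler_norml /dp => /andP[? ?]; apply/andP; split; lra.
rewrite mulrCA [leRHS]mulrCA ler_wpM2l//.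
apply: le_trans (s_le_p Dx).
by rewrite ler_wpM2l// ltW.
Qed.

Let Doo : (mu D < +oo)%E.
Proof. by rewrite lebesgue_measure_itv /=; case: ifP => _; rewrite -?EFinB ltry. Qed.

Let mcont (f : R -> R) : continuous f -> measurable_fun D f.
Proof. by move=> cf; apply: measurable_funTS; exact: continuous_measurable_fun. Qed.

Let cphi n : continuous (phi n) := is_derive_continuous (dphiE n).

Let cq n : continuous (q n).
Proof.
apply: continuous_add => [|x]; last exact: cvg_cst.
apply: continuous_mul; first by move=> x; exact: cvg_cst.
apply: continuous_mul; first by apply: continuous_add => x; [exact: cvg_id|exact: cvg_cst].
by move=> x; apply: cvgB; [exact: cvg_cst|exact: cvg_id].
Qed.

Let cflat j n : continuous (fun x => flat j (q n x)).
Proof.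
move=> x; apply: (@continuous_comp _ _ _ (q n) (flat j)); first exact: cq.
exact: (@Ck_flat R 0 j).
Qed.

Let cdphi n : continuous (dphi n).
Proof.
apply: continuous_add; apply: continuous_mul => //.
  by apply: continuous_mul => // x; exact: cvg_cst.
apply: continuous_mul => //; apply: continuous_mul; first by move=> x; exact: cvg_cst.
move=> x; apply: cvgB; first exact: cvg_cst.
by apply: cvgM; [exact: cvg_cst|exact: cvg_id].
Qed.

Let phi_cvg x : D x -> phi n x @[n --> \oo] --> s x.
Proof.
move=> Dx; apply/subr_cvg0; apply: norm_cvg0.
apply: (@squeeze_cvgr _ _ _ _ (cst 0) (fun n => (q n x)^-1)); last exact: q_cvg.
- apply: filterS (q_pos Dx) => n qn; rewrite normr_ge0 /=.
  by apply: le_trans (phi_le _ _) _; have /andP[] := flat0_bounds qn.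
- exact: cvg_cst.
Qed.

Let dphi_cvg x : D x -> dphi n x @[n --> \oo] --> k * c x.
Proof.
move=> Dx; apply/subr_cvg0; apply: norm_cvg0.
apply: (@squeeze_cvgr _ _ _ _ (cst 0) (fun n => k * (q n x)^-1 +
  2 * k * ((q n x)^-1 + (q n x)^-1 * (q n x)^-1))).
- apply: filterS (q_pos Dx) => n qn; rewrite normr_ge0 /=.
  apply: le_trans (dphi_le Dx qn) _; apply: lerD.
    by rewrite ler_pM2l//; have /andP[] := flat0_bounds qn.
  apply: ler_wpM2l; first by rewrite mulr_ge0// ltW.
  by have [H _] := flat2_bounds qn; rewrite -expr2.
- exact: cvg_cst.
- have H := q_cvg Dx.
  rewrite -[X in _ --> X](_ : k * 0 + 2 * k * (0 + 0 * 0) = 0); last by ring.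
  apply: cvgD; apply: cvgM => //; try exact: cvg_cst.
  by apply: cvgD => //; exact: cvgM.
Qed.

(** 7 = 1 + 2 * 3, from the two terms of [dphi_le]. Where q n <= 0 the cutoff vanishes and the
    difference is k c itself. *)
Let dphi_bound n x : D x -> `|dphi n x - k * c x| <= 7 * k.
Proof.
move=> Dx; have [q0|q0] := ltP 0 (q n x).
  apply: le_trans (dphi_le Dx q0) _.
  have [_ H] := flat2_bounds q0; have /andP[f0 f1] := flat0_01 (q n x).
  have : k * (1 - flat 0 (q n x)) <= k * 1 by rewrite ler_pM2l//; lra.
  have : 2 * k * ((q n x + 1) * flat 2 (q n x)) <= 2 * k * 3 by rewrite ler_pM2l// mulr_gt0.
  lra.
rewrite /dphi /flat ltNge q0 /= !mulr0 addr0 sub0r normrN 1!normrM (ger0_norm (ltW k0)).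
apply: le_trans (ler_wpM2l (ltW k0) (c1 x)) _.
by rewrite mulr1 ler_peMl ?ltW//; lra.
Qed.

Let sqint_cont (f : R -> R) M : continuous f -> (forall x, `|f x| <= M) ->
  square_integrable (leb1 R) D f.
Proof.
move=> cf fM; have mD : measurable (D : set (measurableTypeR R)) by exact: measurable_itv.
exact: (@sqint_bounded R _ (measurableTypeR R) (leb1 R) D mD f M Doo (mcont cf) (fun x _ => fM x)).
Qed.

Let sqint_s : square_integrable (leb1 R) D s.
Proof. exact: sqint_cont s1. Qed.

Let ckc : continuous (fun x => k * c x).
Proof. by apply: continuous_mul => // x; exact: cvg_cst. Qed.

Let sqint_kc : square_integrable (leb1 R) D (fun x => k * c x).
Proof.
apply: (@sqint_cont _ k) => // x.
by rewrite 1!normrM (ger0_norm (ltW k0)) ler_piMr// ltW.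
Qed.

Let partial1E (i : 'I_1) (f df : R -> R) : (forall x, is_derive x (1 : R) f (df x)) ->
  @partial1 R i f = df.
Proof. by move=> d; apply/funext => x; rewrite /partial1 derive1E; have [] := d x. Qed.

Let H10_s : H10 (leb1 R) (@test1 R) (@partial1 R) D s (fun _ x => k * c x).
Proof.
have mD : measurable (D : set (measurableTypeR R)) by exact: measurable_itv.
split => //; exists phi; split => //.
- apply: (@L2_cvg_bounded R _ (measurableTypeR R) (leb1 R) D mD phi s 1) => //.
  + by move=> n; apply: mcont; exact: cphi.
  + exact: mcont.
  + move=> n x _; apply: le_trans (phi_le _ _) _.
    by have /andP[] := flat0_01 (q n x); lra.
- move=> i; have -> : (fun n => @partial1 R i (phi n)) = dphi.
    by apply/funext => n; exact: partial1E (dphiE n).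
 
  apply: (@L2_cvg_bounded R _ (measurableTypeR R) (leb1 R) D mD dphi (fun x => k * c x) (7 * k)) => //.
  + by move=> n; apply: mcont; exact: cdphi.
  + exact: mcont.
Qed.

(** Both sides are limits along the test functions psi n approximating w, and for psi n the identity
    says that (k c psi n)' has integral 0 over [a, b]. *)
Let weak_s w h : H10 (leb1 R) (@test1 R) (@partial1 R) D w h ->
  \int[leb1 R]_(x in D) (k * c x * h 0 x) = \int[leb1 R]_(x in D) (k ^+ 2 * s x * w x).
Proof.
move=> [sw sh [psi [tpsi cpsi dpsi]]].
have mD : measurable (D : set (measurableTypeR R)) by exact: measurable_itv.
have d1 n x : is_derive x (1 : R) (psi n) ('D_1 (psi n) x).
  by apply: smooth_is_derive; have [] := tpsi n.
have cpd n : continuous ('D_1 (psi n)) by have [/(_ [:: 1])[]] := tpsi n.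
have cpn n : continuous (psi n) := is_derive_continuous (d1 n).
have spsi n : square_integrable (leb1 R) D (psi n).
  by have [M HM] := test_function_bounded (tpsi n) [::]; exact: sqint_cont (cpn n) HM.
have sdpsi n : square_integrable (leb1 R) D (@partial1 R 0 (psi n)).
  rewrite (partial1E _ (d1 n)).
  by have [M HM] := test_function_bounded (tpsi n) [:: 1]; exact: sqint_cont (cpd n) HM.
have sks : square_integrable (leb1 R) D (fun x => k ^+ 2 * s x) by exact: sqintZ.
have L := cvg_Rint_mul mD (fun=> sqint_kc) sqint_kc sdpsi (sh 0) (L2_cvg_cst _ _ _) (dpsi 0).
have Rr := cvg_Rint_mul mD (fun=> sks) sks spsi sw (L2_cvg_cst _ _ _) cpsi.
suff E : (fun n => \int[leb1 R]_(x in D) (k ^+ 2 * s x * psi n x)) =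
    (fun n => \int[leb1 R]_(x in D) (k * c x * @partial1 R 0 (psi n) x)).
  by rewrite E in Rr; exact: cvg_unique L Rr.
apply/funext => n; rewrite (partial1E _ (d1 n)).
have I1 : \int[mu]_(x in `[a, b]) (k * c x * 'D_1 (psi n) x - k ^+ 2 * s x * psi n x) = 0.
  have z y : ~ D y -> psi n y = 0.
    by move=> nDy; exact: (test_function_off [::] (tpsi n) nDy).
  transitivity (k * c b * psi n b - k * c a * psi n a); last first.
    by rewrite !z ?mulr0 ?subrr// /D /= in_itv /= ltxx ?andbF.
  apply: (@Rint_derive R (fun x => k * c x * psi n x) _ a b ab).
  - move=> x _; apply: (is_derive_eq (is_derive_mul (is_derive_scale k (dc x)) (d1 n x))).
    ring.
  - move=> x _; apply: continuousB; apply: continuousM; try exact: cpd; try exact: cpn.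
      exact: ckc.
    by apply: continuousM; [exact: cvg_cst|exact: cs].
have i1 : mu.-integrable `[a, b] (EFin \o (fun x => k * c x * 'D_1 (psi n) x)).
  by apply: segment_integrable => x _; apply: continuousM; [exact: ckc|exact: cpd].
have i2 : mu.-integrable `[a, b] (EFin \o (fun x => k ^+ 2 * s x * psi n x)).
  apply: segment_integrable => x _; apply: continuousM; last exact: cpn.
  by apply: continuousM; [exact: cvg_cst|exact: cs].
have seg f : mu.-integrable `[a, b] (EFin \o f) ->
    \int[mu]_(x in D) f x = \int[mu]_(x in `[a, b]) f x.
  move=> fi; rewrite /D Rintegral_itv_obnd_cbnd; last first.
    by apply: integrableS fi => //; apply: subset_itv; rewrite bnd_simp.
  rewrite Rintegral_itv_bndo_bndc//.
  by apply: integrableS fi => //; apply: subset_itv; rewrite bnd_simp.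
move: I1; rewrite RintegralB// => /subr0_eq; rewrite -!seg//.
Qed.

(** An infimum over eigenvalues is at most k^2, which is one, with eigenfunction s. *)
Lemma mu1_itv_le : (mu1 `]a, b[%classic <= ((pi / (b - a)) ^+ 2)%:E)%E.
Proof.
apply: ereal_inf_lbound; exists (k ^+ 2) => //; exists s; split.
- split; first exact: sqintZ.
  exists (fun=> fun x => k * c x); first exact: H10_s.
  move=> w h Hw.
  by under eq_Rintegral do rewrite big_ord1; exact: weak_s.
- move=> [N [mN N0 sub]].
  have DN : D `<=` N by move=> x Dx; apply: sub => /= /(_ Dx) sx; have := s_pos Dx; rewrite sx ltxx.
  have : (leb1 R D <= leb1 R N)%E by apply: le_measure; rewrite ?inE//; exact: measurable_itv.
  by rewrite N0 [leb1 R D]lebesgue_measure_itv /= lte_fin ab -EFinB lee_fin leNgt l0.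
Qed.

End upper_bound_of_mu1.

(** * Open plane sets and the product sigma-algebra *)

Section measurability_in_the_plane.
Context (R : realType).
Notation RB := (measurableTypeR R).

Lemma open_measurable_plane (U : set (R * R)) : open U -> measurable (U : set (RB * RB)).
Proof.
move=> oU.
pose Q (q : rat * rat * rat) : set (R * R) :=
  `](ratr q.1.1 - ratr q.2), (ratr q.1.1 + ratr q.2)[ `*`
  `](ratr q.1.2 - ratr q.2), (ratr q.1.2 + ratr q.2)[.
(* F q is the rational square Q q if it lies in U and is empty otherwise, so the union may run over
   all rational triples. *)
pose F q := [set z | Q q `<=` U /\ Q q z].
have -> : U = \bigcup_q F q.
  apply/seteqP; split => [z Uz|z [q _ [qU Qz]]]; last exact: qU.
  have [e /= e0 zeU] : \forall e \near (0 : R)^'+, ball z e `<=` U.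
    have /nbhs_ballP[r /= r0 rU] := open_nbhs_nbhs (conj oU Uz).
    near=> e; apply: subset_trans rU; apply: le_ball.
    by near: e; exact: nbhs_right_le.
  pose h := e / 2; have h0 : 0 < h by rewrite divr_gt0.
  have hU : ball z h `<=` U.
    by apply: zeU => //=; rewrite /ball_ /= sub0r normrN gtr0_norm// /h; lra.
  have hq3 : h / 4 < h / 2 by lra.
  have [q3] := rat_in_itvoo hq3.
  rewrite in_itv /= => /andP[q3a q3b].
  have hq1 : z.1 - h / 4 < z.1 + h / 4 by lra.
  have [q1] := rat_in_itvoo hq1.
  rewrite in_itv /= => /andP[q1a q1b].
  have hq2 : z.2 - h / 4 < z.2 + h / 4 by lra.
  have [q2] := rat_in_itvoo hq2.
  rewrite in_itv /= => /andP[q2a q2b].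
  exists ((q1, q2), q3) => //; split; last first.
    by split; rewrite /= in_itv /=; apply/andP; split; lra.
  move=> w [] /=; rewrite !in_itv /= => /andP[w1a w1b] /andP[w2a w2b].
  apply: hU; split; rewrite /ball /= ltr_norml; apply/andP; split; lra.
apply: countable_bigcupT_measurable => [|q]; first exact: countableP.
have [qU|nqU] := pselect (Q q `<=` U).
  have -> : F q = Q q by apply/seteqP; split => [z []//|z Qz]; split.
  by apply: measurableX; exact: measurable_itv.
by have -> : F q = set0 by apply/seteqP; split => [z []//|z []].
Unshelve. all: by end_near. Qed.

Lemma continuous_measurable_plane (f : R * R -> R) : continuous f ->
  measurable_fun [set: RB * RB] (f : RB * RB -> R).
Proof.
move=> /continuousP cf; apply: (measurability _ (RGenOpens.measurableE R)).
move=> _ [_ [a [b ->] <-]]; rewrite setTI; apply: open_measurable_plane.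
exact/cf/interval_open.
Qed.

Lemma measurable_open_section (U : set (R * R)) x : open U ->
  measurable (xsection U x : set RB).
Proof. by move=> oU; apply: measurable_xsection; exact: open_measurable_plane. Qed.

End measurability_in_the_plane.

(** * Integrals of functions dominated by a product *)

Section product_bound.
Local Open Scope ereal_scope.
Context d1 d2 (T1 : measurableType d1) (T2 : measurableType d2) (R : realType).
Variables (m1 : {sigma_finite_measure set T1 -> \bar R}).
Variables (m2 : {sigma_finite_measure set T2 -> \bar R}).

Lemma integral_le_prod (f : T1 * T2 -> \bar R) (F : T1 -> \bar R) (G : T2 -> \bar R) :
  measurable_fun setT f -> (forall z, 0 <= f z) ->
  measurable_fun setT F -> measurable_fun setT G ->
  (forall x, 0 <= F x) -> (forall y, 0 <= G y) -> (forall x y, f (x, y) <= F x * G y) ->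
  \int[m1 \x m2]_z f z <= (\int[m1]_x F x) * (\int[m2]_y G y).
Proof.
move=> mf f0 mF mG F0 G0 fFG; rewrite fubini_tonelli1//.
rewrite -ge0_integralZr//; last exact: integral_ge0.
apply: ge0_le_integral => //.
- by move=> x _; exact: integral_ge0.
- exact: measurable_fun_fubini_tonelli_F.
- by apply: emeasurable_funM.
move=> x _; rewrite -ge0_integralZl//.
apply: ge0_le_integral => //.
- exact: measurableT_comp mf (pair1_measurable x).
- exact: emeasurable_funM.
Qed.

End product_bound.

(** Arithmetic for [mass_le_partials_test]: n is the squared L^2 norm of the function, f and g are
    the L^1 norms of its partial derivatives, Y and X their squared L^2 norms, and A is the area. *)
Lemma sqr_le_of_product_bounds (R : realFieldType) (n X Y A f g : R) :
  0 <= n -> 0 <= f -> 0 <= g -> 2 ^+ 2 * n <= f * g -> f ^+ 2 <= A * Y -> g ^+ 2 <= A * X ->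
  n ^+ 2 <= (A / 4) ^+ 2 * (X * Y).
Proof.
move=> n0 f0 g0 K H1 H0.
have S : (2 ^+ 2 * n) ^+ 2 <= (f * g) ^+ 2 by rewrite lerXn2r ?nnegrE ?mulr_ge0.
have P : f ^+ 2 * g ^+ 2 <= A * Y * (A * X) by apply: ler_pM; rewrite ?sqr_ge0.
rewrite (_ : n ^+ 2 = (2 ^+ 2 * n) ^+ 2 / 16); last by field.
rewrite (_ : _ * (X * Y) = (A * Y * (A * X)) / 16); last by field.
by rewrite ler_pM2r ?invr_gt0// (le_trans S)// exprMn.
Qed.

(** * Inequalities for test functions, integrated along lines *)

Section test_functions_on_plane_domains.
Context (R : realType).
Notation RB := (measurableTypeR R).
Notation leb := (@lebesgue_measure R).
Variables (Omega : set (R * R)) (M : R).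
Hypothesis oOmega : open Omega.
Hypothesis fOmega : (leb2 R Omega < +oo)%E.
Hypothesis bOmega : forall z, Omega z -> `|z.1| < M /\ `|z.2| < M.
Implicit Types phi : R * R -> R.

Let mOmega : measurable (Omega : set (RB * RB)).
Proof. exact: open_measurable_plane. Qed.

Lemma continuous_test2 phi vs : @test2 R Omega phi -> continuous (@iter_derive R (R * R)%type phi vs).
Proof. by move=> [/(_ vs)[]]. Qed.

Lemma sqint_test2 phi vs : @test2 R Omega phi ->
  square_integrable (leb2 R) Omega (@iter_derive R (R * R)%type phi vs).
Proof.
move=> tphi; have [B HB] := test_function_bounded tphi vs.
apply: (@sqint_bounded _ _ _ (leb2 R) Omega mOmega _ B fOmega) => [|z _]; last exact: HB.
by apply: measurable_funTS; apply: continuous_measurable_plane; exact: continuous_test2.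
Qed.

Lemma is_derive_vertical phi x y : smooth phi ->
  is_derive y (1 : R) (fun y => phi (x, y)) (@partial2 R 1 phi (x, y)).
Proof.
move=> sphi; have E t : (x, t) = t *: ((0, 1) : R * R) + (x, 0).
  by apply: injective_projections; rewrite /= ?scaler0 ?add0r ?addr0// [_ *: _]mulr1.
have -> : (fun y => phi (x, y)) = (fun t : R => phi (t *: ((0, 1) : R * R) + (x, 0))).
  by apply/funext => t; rewrite E.
by apply: is_derive_line_at; rewrite -E; exact: smooth_is_derive.
Qed.

Lemma is_derive_horizontal phi x y : smooth phi ->
  is_derive x (1 : R) (fun x => phi (x, y)) (@partial2 R 0 phi (x, y)).
Proof.
move=> sphi; have E t : (t, y) = t *: ((1, 0) : R * R) + (0, y).
  by apply: injective_projections; rewrite /= ?scaler0 ?add0r ?addr0// [_ *: _]mulr1.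
have -> : (fun x => phi (x, y)) = (fun t : R => phi (t *: ((1, 0) : R * R) + (0, y))).
  by apply/funext => t; rewrite E.
by apply: is_derive_line_at; rewrite -E; exact: smooth_is_derive.
Qed.

Lemma continuous_vertical (f : R * R -> R) x : continuous f -> continuous (fun y => f (x, y)).
Proof.
move=> cf y; apply: (@continuous_comp _ _ _ (fun y => (x, y)) f); last exact: cf.
exact: (@cvg_pair _ _ _ (nbhs y) (nbhs x) (nbhs y) _ _ _ (cst x) id (cvg_cst x) cvg_id).
Qed.

Lemma continuous_horizontal (f : R * R -> R) y : continuous f -> continuous (fun x => f (x, y)).
Proof.
move=> cf x; apply: (@continuous_comp _ _ _ (fun x => (x, y)) f); last exact: cf.
exact: (@cvg_pair _ _ _ (nbhs x) (nbhs x) (nbhs y) _ _ _ id (cst y) cvg_id (cvg_cst y)).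
Qed.

Lemma integral_off_domain (F : R * R -> \bar R) : (forall z, ~ Omega z -> F z = 0%E) ->
  (\int[leb2 R]_(z in Omega) F z = \int[leb2 R]_z F z)%E.
Proof.
move=> F0; rewrite [LHS]integral_mkcond; apply: eq_integral => z _; rewrite patchE.
by case: ifPn => // /negP; rewrite inE => /F0.
Qed.

(** The weight is constant on each vertical line, so [poincare_line] applies to w phi there and
    Tonelli integrates the result in x_1. No regularity in x_1 is used, which admits indicator
    weights. *)
Lemma weighted_poincare_test (w : R -> R) (k : R) phi : 0 <= k ->
  measurable_fun [set: RB] (w : RB -> R) -> (exists B, forall x, `|x| < M -> `|w x| <= B) ->
  (forall x, w x != 0 -> exists a b, [/\ a < b, xsection Omega x `<=` `]a, b[ &
     k <= (pi / (b - a)) ^+ 2]) ->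
  @test2 R Omega phi ->
  k * nrm2 (leb2 R) Omega (fun z => w z.1 * phi z) <=
  nrm2 (leb2 R) Omega (fun z => w z.1 * @partial2 R 1 phi z).
Proof.
move=> k0 mw [B wB] sec tphi.
have mw2 : measurable_fun [set: RB * RB] (fun z : RB * RB => w z.1).
  exact: measurableT_comp mw measurable_fst.
have wB2 z : Omega z -> `|w z.1| <= B.
  by move=> Oz; apply: wB; have [] := bOmega Oz.
have sphi : square_integrable (leb2 R) Omega (fun z => w z.1 * phi z).
  apply: (@sqint_bounded_mul R _ _ (leb2 R) Omega mOmega (fun z => w z.1) B phi) => //.
    exact: measurable_funTS.
  exact: sqint_test2 [::] tphi.
have sdphi : square_integrable (leb2 R) Omega (fun z => w z.1 * @partial2 R 1 phi z).
  apply: (@sqint_bounded_mul R _ _ (leb2 R) Omega mOmega (fun z => w z.1) B (@partial2 R 1 phi)) => //.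
    exact: measurable_funTS.
  exact: sqint_test2 [:: (0, 1)] tphi.
have off z : ~ Omega z -> phi z = 0 := test_function_off [::] tphi.
have offd z : ~ Omega z -> @partial2 R 1 phi z = 0.
  by move=> nz; exact: (test_function_off [:: _] tphi nz).
rewrite -lee_fin EFinM -(nrm2E mOmega sphi) -(nrm2E mOmega sdphi).
have cphi := continuous_test2 (vs := [::]) tphi.
have cdphi := continuous_test2 (vs := [:: (0, 1)]) tphi.
have mphi : measurable_fun [set: RB * RB] (fun z : RB * RB => ((w z.1 * phi z) ^+ 2)%:E).
  apply/measurable_EFinP/measurable_funX/measurable_funM => //.
  exact: continuous_measurable_plane.
have mdphi : measurable_fun [set: RB * RB]
    (fun z : RB * RB => ((w z.1 * @partial2 R 1 phi z) ^+ 2)%:E).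
  apply/measurable_EFinP/measurable_funX/measurable_funM => //.
  exact: continuous_measurable_plane.
rewrite !integral_off_domain; last 2 first.
- by move=> z nz; rewrite ?off ?offd// mulr0 expr0n.
- by move=> z nz; rewrite ?off ?offd// mulr0 expr0n.
rewrite /leb2 !fubini_tonelli1//; try by move=> z; rewrite lee_fin sqr_ge0.
have mF : measurable_fun [set: RB] (fubini_F leb (fun z => ((w z.1 * phi z) ^+ 2)%:E)).
  by apply: measurable_fun_fubini_tonelli_F => // z; rewrite lee_fin sqr_ge0.
have mG : measurable_fun [set: RB]
    (fubini_F leb (fun z => ((w z.1 * @partial2 R 1 phi z) ^+ 2)%:E)).
  by apply: measurable_fun_fubini_tonelli_F => // z; rewrite lee_fin sqr_ge0.
rewrite -ge0_integralZl//; last first.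
  by move=> x _; apply: integral_ge0 => y _; rewrite lee_fin sqr_ge0.
apply: ge0_le_integral => //.
- by move=> x _; apply: mule_ge0 => //; apply: integral_ge0 => y _; rewrite lee_fin sqr_ge0.
- exact: measurable_funeM.
move=> x _; rewrite /fubini_F /=.
(* Where the weight vanishes the section may be wide: both sides are controlled without Poincare. *)
have [wx|wx] := eqVneq (w x) 0.
  by under eq_integral do rewrite wx mul0r expr0n/=; rewrite integral0 mule0;
    apply: integral_ge0 => y _; rewrite lee_fin sqr_ge0.
have [a [b [ab sub kab]]] := sec x wx.
have d y : is_derive y (1 : R) (fun y => w x * phi (x, y)) (w x * @partial2 R 1 phi (x, y)).
  by apply: is_derive_scale; apply: is_derive_vertical; case: tphi.
apply: le_trans (poincare_line ab d _ _).
- apply: lee_wpmul2r; last by rewrite lee_fin.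
  by apply: integral_ge0 => y _; rewrite lee_fin sqr_ge0.
- apply: continuous_mul; first by move=> y; exact: cvg_cst.
  exact: (@continuous_vertical _ x cdphi).
- move=> y ny; rewrite off ?mulr0// => xy; apply: ny; apply: sub.
  by apply/xsectionP.
Qed.

(** The argument of Gagliardo and Nirenberg: 2 |phi(x, y)| is at most a function of x alone and also
    a function of y alone, so 4 phi^2 integrates to at most a product of L^1 norms, which
    Cauchy-Schwarz over Omega turns into L^2 norms. *)
Lemma mass_le_partials_test phi : @test2 R Omega phi ->
  (nrm2 (leb2 R) Omega phi) ^+ 2 <=
  (fine (leb2 R Omega) / 4) ^+ 2 *
  (nrm2 (leb2 R) Omega (@partial2 R 0 phi) * nrm2 (leb2 R) Omega (@partial2 R 1 phi)).
Proof.
move=> tphi; set A := fine _.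
have AE : leb2 R Omega = A%:E by rewrite fineK// ge0_fin_numE.
have sphi : square_integrable (leb2 R) Omega phi by exact: (sqint_test2 [::] tphi).
have cphi := continuous_test2 (vs := [::]) tphi.
have smphi : smooth phi by case: tphi.
have cd i : continuous (@partial2 R i phi) by exact: (continuous_test2 (vs := [:: _]) tphi).
have sd i : square_integrable (leb2 R) Omega (@partial2 R i phi).
  exact: (sqint_test2 [:: _] tphi).
have md i : measurable_fun [set: RB * RB] (fun z : RB * RB => `|@partial2 R i phi z|%:E).
  by apply/measurable_EFinP/measurableT_comp => //; exact: continuous_measurable_plane.
have off i z : ~ Omega z -> @partial2 R i phi z = 0.
  by move=> nz; exact: (test_function_off [:: _] tphi nz).
pose N i := (\int[leb2 R]_z `|@partial2 R i phi z|%:E)%E.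
have N0 i : (0 <= N i)%E by apply: integral_ge0 => z _; rewrite lee_fin.
have s1 : square_integrable (leb2 R) Omega (fun=> 1 : R).
  by apply: (@sqint_bounded _ _ _ (leb2 R) Omega mOmega _ 1 fOmega) => // z _; rewrite normr1.
have sa i : square_integrable (leb2 R) Omega (fun z => `|@partial2 R i phi z|).
  split; first by apply: measurableT_comp => //; exact: sqint_measurable (sd i).
  by have [_] := sd i; under eq_integral do rewrite -(real_normK (num_real _)).
have NE i : N i = (\int[leb2 R]_(z in Omega) (1 * `|@partial2 R i phi z|))%:E.
  rewrite /N -integral_off_domain; last by move=> z nz; rewrite off// normr0.
  rewrite /Rintegral; under [in RHS]eq_integral do rewrite mul1r.
  rewrite fineK//; apply: integrable_fin_num => //.
  by have := sqint_integrable_mul mOmega s1 (sa i); apply: eq_integrable => // z _ /=; rewrite mul1r.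
have N2 i : (fine (N i)) ^+ 2 <= A * nrm2 (leb2 R) Omega (@partial2 R i phi).
  rewrite NE; apply: le_trans (cauchy_schwarz mOmega s1 (sa i)) _.
  rewrite /nrm2 (_ : \int[leb2 R]_(x in Omega) (1 ^+ 2) = A); last first.
    under eq_Rintegral do rewrite expr1n.
    by rewrite Rintegral_cst// mul1r.
  by under eq_Rintegral do rewrite real_normK ?num_real//.
have Hx x y : ((2 * `|phi (x, y)|)%:E <= fubini_F leb (fun z => `|@partial2 R 1 phi z|%:E) x)%E.
  (* The interval with ends -(|M| + 1) and |M| + 1 contains every section and is non-degenerate
     whatever the sign of M. *)
  apply: (@le_half_int_derive R (fun y => phi (x, y)) (fun y => @partial2 R 1 phi (x, y))
    (- (`|M| + 1)) (`|M| + 1)).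
  - by have := normr_ge0 M; lra.
  - by move=> t; exact: is_derive_vertical.
  - exact: continuous_vertical.
  - move=> t nt; apply: (test_function_off [::] tphi) => /bOmega[_ /= tM]; apply: nt.
    rewrite /= in_itv /= -ltr_norml (lt_le_trans tM)//.
    by rewrite (le_trans (ler_norm M))// lerDl.
have Hy x y : ((2 * `|phi (x, y)|)%:E <= fubini_G leb (fun z => `|@partial2 R 0 phi z|%:E) y)%E.
  apply: (@le_half_int_derive R (fun x => phi (x, y)) (fun x => @partial2 R 0 phi (x, y))
    (- (`|M| + 1)) (`|M| + 1)).
  - by have := normr_ge0 M; lra.
  - by move=> t; exact: is_derive_horizontal.
  - exact: continuous_horizontal.
  - move=> t nt; apply: (test_function_off [::] tphi) => /bOmega[/= tM _]; apply: nt.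
    rewrite /= in_itv /= -ltr_norml (lt_le_trans tM)//.
    by rewrite (le_trans (ler_norm M))// lerDl.
have mphi2 : measurable_fun [set: RB * RB] (fun z : RB * RB => ((2 * phi z) ^+ 2)%:E).
  apply/measurable_EFinP/measurable_funX/measurable_funM => //.
  exact: continuous_measurable_plane.
have K : (\int[leb2 R]_z ((2 * phi z) ^+ 2)%:E <= N 1%R * N 0%R)%E.
  rewrite /N /leb2 [X in (_ <= X * _)%E]fubini_tonelli1// [X in (_ <= _ * X)%E]fubini_tonelli2//.
  apply: integral_le_prod => //.
  - by move=> z; rewrite lee_fin sqr_ge0.
  - by apply: measurable_fun_fubini_tonelli_F => // z; rewrite lee_fin.
  - by apply: measurable_fun_fubini_tonelli_G => // z; rewrite lee_fin.
  - by move=> x; apply: integral_ge0 => y _; rewrite lee_fin.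
  - by move=> y; apply: integral_ge0 => x _; rewrite lee_fin.
  move=> x y; rewrite -real_normK ?num_real// normrM (@ger0_norm _ 2)// expr2 EFinM.
  have p0 : (0 <= (2 * `|phi (x, y)|)%:E)%E by rewrite lee_fin mulr_ge0.
  exact: (lee_pmul p0 p0 (Hx x y) (Hy x y)).
move: K; rewrite -integral_off_domain; last first.
  by move=> z nz /=; rewrite [phi z](test_function_off [::] tphi nz) mulr0 expr0n.
rewrite (nrm2E mOmega (sqintZ mOmega 2 sphi)) (nrm2Z mOmega 2 sphi).
have [N1r N0r] : 0 <= fine (N 1%R) /\ 0 <= fine (N 0%R) by split; exact: fine_ge0.
have NF i : N i = (fine (N i))%:E by rewrite NE.
rewrite (NF 1) (NF 0) -EFinM lee_fin => K.
exact: (sqr_le_of_product_bounds (nrm2_ge0 _ _ _) N1r N0r K (N2 1) (N2 0)).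
Qed.

End test_functions_on_plane_domains.

Lemma sum_ord2 (V : nmodType) (F : 'I_2 -> V) : \sum_(i < 2) F i = F 0 + F 1.
Proof. by rewrite big_ord_recl big_ord1; congr (F _ + F _); exact: val_inj. Qed.

(** * Passage to H^1_0 and the weighted energy identity *)

Section dirichlet_space_of_plane_domains.
Context (R : realType).
Notation RB := (measurableTypeR R).
Variables (Omega : set (R * R)) (M : R).
Hypothesis oOmega : open Omega.
Hypothesis fOmega : (leb2 R Omega < +oo)%E.
Hypothesis bOmega : forall z, Omega z -> `|z.1| < M /\ `|z.2| < M.

Notation H102 := (H10 (leb2 R) (@test2 R) (@partial2 R) Omega).
Notation sqint := (square_integrable (leb2 R) Omega).
Notation nrm := (nrm2 (leb2 R) Omega).

Let mOmega : measurable (Omega : set (RB * RB)).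
Proof. exact: open_measurable_plane. Qed.

(** The bound is over |x| < M, which contains the projection of Omega; this admits exponentials. *)
Definition bounded_weight (w : R -> R) :=
  measurable_fun [set: RB] (w : RB -> R) /\ exists B, forall x, `|x| < M -> `|w x| <= B.

Lemma sqint_weight w (f : R * R -> R) : bounded_weight w -> sqint f ->
  sqint (fun z => w z.1 * f z).
Proof.
move=> [mw [B wB]] sf.
apply: (@sqint_bounded_mul R _ _ (leb2 R) Omega mOmega (fun z => w z.1) B f) => //.
  by apply: measurable_funTS; exact: measurableT_comp mw measurable_fst.
by move=> z Oz; apply: wB; have [] := bOmega Oz.
Qed.

Lemma L2_cvg_weight w (f_ : nat -> R * R -> R) f : bounded_weight w ->
  (forall n, sqint (f_ n)) -> sqint f -> L2_cvg (leb2 R) Omega f_ f ->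
  L2_cvg (leb2 R) Omega (fun n z => w z.1 * f_ n z) (fun z => w z.1 * f z).
Proof.
move=> [mw [B wB]] sf_ sf cf.
apply: (@L2_cvg_bounded_mul R _ _ (leb2 R) Omega mOmega (fun z => w z.1) B f_ f) => //.
  by apply: measurable_funTS; exact: measurableT_comp mw measurable_fst.
by move=> z Oz; apply: wB; have [] := bOmega Oz.
Qed.

Lemma weighted_poincare (w : R -> R) (k : R) u g : 0 <= k -> bounded_weight w ->
  (forall x, w x != 0 -> exists a b, [/\ a < b, xsection Omega x `<=` `]a, b[ &
     k <= (pi / (b - a)) ^+ 2]) ->
  H102 u g -> k * nrm (fun z => w z.1 * u z) <= nrm (fun z => w z.1 * g 1 z).
Proof.
move=> k0 bw sec [su sg [phi [tphi cphi dphi]]].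
have sphi n : sqint (phi n) by exact: (@sqint_test2 R Omega oOmega fOmega (phi n) [::]).
have sdphi n : sqint (@partial2 R 1 (phi n)).
  exact: (@sqint_test2 R Omega oOmega fOmega (phi n) [:: _]).
have C1 := cvg_nrm2 mOmega (fun n => sqint_weight bw (sphi n)) (sqint_weight bw su)
  (L2_cvg_weight bw sphi su cphi).
have C2 := cvg_nrm2 mOmega (fun n => sqint_weight bw (sdphi n)) (sqint_weight bw (sg 1))
  (L2_cvg_weight bw sdphi (sg 1) (dphi 1)).
apply: (ler_cvg_to (cvgM (cvg_cst k) C1) C2); near=> n.
by case: bw => mw B; exact: (@weighted_poincare_test R Omega M oOmega fOmega bOmega).
Unshelve. all: by end_near. Qed.

Lemma mass_le_partials u g : H102 u g ->
  (nrm u) ^+ 2 <= (fine (leb2 R Omega) / 4) ^+ 2 * (nrm (g 0) * nrm (g 1)).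
Proof.
move=> [su sg [phi [tphi cphi dphi]]].
have sphi n : sqint (phi n) by exact: (@sqint_test2 R Omega oOmega fOmega (phi n) [::]).
have sdphi i n : sqint (@partial2 R i (phi n)).
  exact: (@sqint_test2 R Omega oOmega fOmega (phi n) [:: _]).
have C := cvg_nrm2 mOmega sphi su cphi.
have C0 := cvg_nrm2 mOmega (sdphi 0) (sg 0) (dphi 0).
have C1 := cvg_nrm2 mOmega (sdphi 1) (sg 1) (dphi 1).
rewrite expr2.
apply: (ler_cvg_to (cvgM C C) (cvgM (cvg_cst ((fine (leb2 R Omega) / 4) ^+ 2)) (cvgM C0 C1))).
near=> n; have := @mass_le_partials_test R Omega M oOmega fOmega bOmega _ (tphi n).
by rewrite expr2.
Unshelve. all: by end_near. Qed.

Definition exp_weight (c : R) (x : R) : R := expR (c * x).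

Lemma bounded_exp_weight c : bounded_weight (exp_weight c).
Proof.
split.
  apply: continuous_measurable_fun => x; apply: continuous_comp; last exact: continuous_expR.
  by apply: cvgM; [exact: cvg_cst|exact: cvg_id].
exists (expR (`|c| * M)) => x xM; rewrite ger0_norm ?expR_ge0// ler_expR.
by apply: le_trans (ler_norm _) _; rewrite normrM ler_wpM2l// ltW.
Qed.

Lemma is_derive_exp_weight c (z v : R * R) :
  is_derive z v (fun z => exp_weight c z.1) (c * v.1 * exp_weight c z.1).
Proof.
apply/is_derive_line.
have d : is_derive (0 : R) (1 : R) (fun t : R => c * (t * v.1 + z.1)) (c * v.1).
  apply: is_derive_scale.
  have := is_derive_add (is_derive_mul (is_derive_id (0 : R) (1 : R))
    (is_derive_cst v.1 (0 : R) (1 : R))) (is_derive_cst z.1 (0 : R) (1 : R)).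
  by move=> H; apply: (is_derive_eq H); rewrite mulr0 add0r addr0 mulr1.
have := @is_derive1_comp _ expR (fun t : R => c * (t * v.1 + z.1)) _ _ _ (is_derive_expR _) d.
by rewrite mul0r add0r mulrC.
Qed.

(** Multiplying the approximating sequence by the weight keeps it in C_c^oo, with supports inside
    the old ones, and the weight being bounded on Omega preserves L^2 convergence. Only the
    horizontal derivative gains a term. *)
Lemma H10_exp_weight c u g : H102 u g ->
  H102 (fun z => exp_weight c z.1 * u z)
    (fun i z => exp_weight c z.1 * (g i z + (if i == 0 then c else 0) * u z)).
Proof.
move=> [su sg [phi [tphi cphi dphi]]].
have bw := bounded_exp_weight c.
have sphi n : sqint (phi n) by exact: (@sqint_test2 R Omega oOmega fOmega (phi n) [::]).
have sdphi i n : sqint (@partial2 R i (phi n)).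
  exact: (@sqint_test2 R Omega oOmega fOmega (phi n) [:: _]).
have sh i : sqint (fun z => g i z + (if i == 0 then c else 0) * u z).
  by apply: sqintD => //; exact: sqintZ.
split.
- exact: sqint_weight.
- by move=> i; exact: sqint_weight.
exists (fun n z => exp_weight c z.1 * phi n z); split.
- move=> n; have [sm cK KO] := tphi n.
  have sub : closure [set z | exp_weight c z.1 * phi n z != 0] `<=`
      closure [set z | phi n z != 0].
    by apply: closure_subset => z /=; apply: contra_neq => ->; rewrite mulr0.
  split; last exact: subset_trans KO.
    apply: (@smooth_exp_mul R (R * R)%type _ (fun v => c * v.1)) => //.
      move=> z; apply: (@continuous_comp _ _ _ fst (exp_weight c)); first exact: cvg_fst.
      apply: continuous_comp; last exact: continuous_expR.
      by apply: cvgM; [exact: cvg_cst|exact: cvg_id].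
    by move=> x v; exact: is_derive_exp_weight.
  by apply: (subclosed_compact _ cK sub); exact: closed_closure.
- exact: L2_cvg_weight.
- move=> i.
  have -> : (fun n => @partial2 R i (fun z => exp_weight c z.1 * phi n z)) =
    (fun n z => exp_weight c z.1 * (@partial2 R i (phi n) z + (if i == 0 then c else 0) * phi n z)).
    apply/funext => n; apply/funext => z; have [sm _ _] := tphi n.
    pose v : R * R := if i == 0 then (1, 0) else (0, 1).
    have [_ E] := is_derive_mul (is_derive_exp_weight c z v) (smooth_is_derive z v sm).
    rewrite [LHS]E (_ : c * v.1 = if i == 0 then c else 0); last first.
      by rewrite /v; case: ifP => _; rewrite ?mulr1 ?mulr0.
    by rewrite mulrDr -[partial2 i (phi n) z]/('D_v (phi n) z); ring.
  apply: L2_cvg_weight => //.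
    by move=> n; apply: sqintD => //; exact: sqintZ.
  apply: L2_cvgD => //; [by move=> n; exact: sqintZ|exact: sqintZ|exact: L2_cvgZ].
Qed.

Section eigenfunction.
Variables (l : R) (u : R * R -> R) (g : 'I_2 -> R * R -> R).
Hypothesis Hu : H102 u g.
Hypothesis weak : forall w h, H102 w h ->
  \int[leb2 R]_(x in Omega) (\sum_(i < 2) g i x * h i x) =
  \int[leb2 R]_(x in Omega) (l * u x * w x).

Let su : sqint u. Proof. by case: Hu. Qed.
Let sg i : sqint (g i). Proof. by case: Hu. Qed.

(* Test the equation with e^(2 b x) u and complete the square. *)
Lemma energy_identity b :
  nrm (fun z => b * (exp_weight b z.1 * u z) + exp_weight b z.1 * g 0 z) +
  nrm (fun z => exp_weight b z.1 * g 1 z) =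
  (l + b ^+ 2) * nrm (fun z => exp_weight b z.1 * u z).
Proof.
have bw := bounded_exp_weight b.
have sv := sqint_weight bw su.
have sw i := sqint_weight bw (sg i).
have e2 x : exp_weight (2 * b) x = exp_weight b x * exp_weight b x.
  by rewrite /exp_weight -expRD; congr expR; ring.
have := weak (H10_exp_weight (2 * b) Hu).
rewrite (_ : \int[leb2 R]_(x in Omega) (l * u x * _) = l * nrm (fun z => exp_weight b z.1 * u z)); last first.
  rewrite /nrm2 -RintegralZl//; last exact: sqint_integrable_sqr.
  by apply: eq_Rintegral => z _; rewrite e2; ring.
rewrite (_ : \int[leb2 R]_(x in Omega) _ =
    nrm (fun z => exp_weight b z.1 * g 0 z) +
    2 * b * \int[leb2 R]_(z in Omega) ((exp_weight b z.1 * u z) * (exp_weight b z.1 * g 0 z)) +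
    nrm (fun z => exp_weight b z.1 * g 1 z)); last first.
  have i1 := sqint_integrable_sqr (sw 0).
  have i2 := sqint_integrable_sqr (sw 1).
  have i3 := sqint_integrable_mul mOmega (sqintZ mOmega (2 * b) sv) (sw 0).
  rewrite -(Rint_mulZl mOmega)// /nrm2 -RintegralD// -RintegralD//; last first.
    by have := integrableD mOmega i1 i3; apply: eq_integrable.
  apply: eq_Rintegral => z _; rewrite sum_ord2 /= e2; ring.
rewrite nrm2DZ// => H; rewrite [RHS]mulrDl -H; ring.
Qed.

Lemma energy_le b : nrm (fun z => exp_weight b z.1 * g 1 z) <=
  (l + b ^+ 2) * nrm (fun z => exp_weight b z.1 * u z).
Proof. by rewrite -energy_identity lerDr nrm2_ge0. Qed.

Lemma energy : nrm (g 0) + nrm (g 1) = l * nrm u.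
Proof.
have E f : nrm (fun z => exp_weight 0 z.1 * f z) = nrm f.
  by apply: eq_Rintegral => z _; rewrite /exp_weight mul0r expR0 mul1r.
have := energy_identity 0; rewrite !E expr0n addr0 => <-; congr (_ + _).
by apply: eq_Rintegral => z _; rewrite /exp_weight !mul0r add0r expR0 mul1r.
Qed.

End eigenfunction.

End dirichlet_space_of_plane_domains.

(** * Agmon's estimate *)

Section exponential_decay_of_eigenfunctions.
Context (R : realType).
Notation RB := (measurableTypeR R).
Variables (Omega : set (R * R)) (M : R).
Hypothesis oOmega : open Omega.
Hypothesis fOmega : (leb2 R Omega < +oo)%E.
Hypothesis bOmega : forall z, Omega z -> `|z.1| < M /\ `|z.2| < M.

Notation H102 := (H10 (leb2 R) (@test2 R) (@partial2 R) Omega).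
Notation sqint := (square_integrable (leb2 R) Omega).
Notation nrm := (nrm2 (leb2 R) Omega).

Let mOmega : measurable (Omega : set (RB * RB)).
Proof. exact: open_measurable_plane. Qed.

(** A geometric stand-in for mu(Omega(x)) >= k: the quotient is the first eigenvalue of ]a, b[.
    Empty sections satisfy it for every k. *)
Definition narrow_section (k x : R) := exists a b,
  [/\ a < b, xsection Omega x `<=` `]a, b[ & k <= (pi / (b - a)) ^+ 2].

Variables (l m : R) (u : R * R -> R) (g : 'I_2 -> R * R -> R).
Hypothesis Hu : H102 u g.
Hypothesis weak : forall w h, H102 w h ->
  \int[leb2 R]_(x in Omega) (\sum_(i < 2) g i x * h i x) =
  \int[leb2 R]_(x in Omega) (l * u x * w x).
Hypothesis u1 : nrm u = 1.
Hypothesis m0 : 0 <= m.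
Hypothesis sec : forall x, narrow_section m x.

Let su : sqint u. Proof. by case: Hu. Qed.
Let sg i : sqint (g i). Proof. by case: Hu. Qed.

(** The horizontal and vertical energies X and Y of u add up to l, and Y >= m by Poincare. The bound
    1 <= (A / 4)^2 X Y forces X > 0, hence m < l strictly, and with X Y <= (l / 2)^2 it becomes 8 <=
    A l. *)
Lemma eigenvalue_bounds : m < l /\ 8 <= fine (leb2 R Omega) * l.
Proof.
set A := fine _; set X := nrm (g 0); set Y := nrm (g 1).
have bw1 : bounded_weight M (fun=> 1 : R).
  by split; [exact: measurable_cst|exists 1 => x _; rewrite normr1].
have mY : m <= Y.
  have := @weighted_poincare R Omega M oOmega fOmega bOmega _ m u g m0 bw1 (fun x _ => sec x) Hu.
  rewrite (_ : nrm (fun z => 1 * u z) = nrm u); last by apply: eq_Rintegral => z _; rewrite mul1r.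
  rewrite (_ : nrm (fun z => 1 * g 1 z) = Y); last by apply: eq_Rintegral => z _; rewrite mul1r.
  by rewrite u1 mulr1.
have XYl : X + Y = l by rewrite /X /Y (@energy R Omega M oOmega fOmega bOmega l u g Hu weak) u1 mulr1.
have mass := @mass_le_partials R Omega M oOmega fOmega bOmega u g Hu.
rewrite u1 expr1n -/A -/X -/Y in mass.
have X0 : 0 <= X by exact: nrm2_ge0.
have Y0 : 0 <= Y by exact: nrm2_ge0.
have A0 : 0 <= A by exact: fine_ge0.
clearbody X Y A.
have Xp : 0 < X.
  rewrite lt_neqAle X0 andbT eq_sym; apply: contraTneq mass => ->.
  by rewrite mul0r mulr0 -ltNge.
split; first by lra.
rewrite -(@ler_pXn2r _ 2)// ?nnegrE ?mulr_ge0//; last by lra.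
have H : X * Y <= (l / 2) ^+ 2 by rewrite -XYl; have := sqr_ge0 (X - Y); lra.
have := ler_wpM2l (sqr_ge0 (A / 4)) H; nra.
Qed.

Lemma bounded_weight_if (c : R -> bool) w1 w2 : measurable_fun [set: RB] (c : RB -> bool) ->
  bounded_weight M w1 -> bounded_weight M w2 ->
  bounded_weight M (fun x => if c x then w1 x else w2 x).
Proof.
move=> mc [m1 [B1 H1]] [m2 [B2 H2]]; split; first exact: measurable_fun_ifT.
exists (Num.max B1 B2) => x xM; case: ifP => _; rewrite le_max ?H1// H2//.
by rewrite orbT.
Qed.

Lemma bounded_weight_cst c : bounded_weight M (fun=> c : R).
Proof. by split; [exact: measurable_cst|exists `|c|]. Qed.

(** The sign s selects an end of Omega. In the weighted energy inequality Poincare has constant k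
    beyond rho and m before it, so the weighted mass beyond rho is controlled by that before rho,
    where the squared weight is at most e^(2 b rho); beyond 2 rho it is at least e^(4 b rho). *)
Lemma agmon_tail (s b rho k : R) : s ^+ 2 = 1 -> 0 <= b -> 0 <= rho -> 0 <= k ->
  m <= l -> l + b ^+ 2 <= k ->
  (forall x, rho <= s * x -> narrow_section k x) ->
  (k - l - b ^+ 2) * nrm (fun z => (if 2 * rho <= s * z.1 then 1 else 0) * u z) <=
  (l + b ^+ 2 - m) * expR (- (2 * b * rho)).
Proof.
move=> s1 b0 rho0 k0 ml lk seck.
pose e := exp_weight (s * b).
pose P x := rho <= s * x.
have mP c : measurable_fun [set: RB] ((fun x => c <= s * x) : RB -> bool).
  by apply: measurable_fun_ler; [exact: measurable_cst|exact: mulrl_measurable].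
pose w1 x := if P x then e x else 0.
pose w2 x := if P x then 0 else e x.
pose t x := if 2 * rho <= s * x then 1 else 0 : R.
have be : bounded_weight M e by exact: bounded_exp_weight.
have b1 : bounded_weight M w1 := bounded_weight_if (mP rho) be (bounded_weight_cst 0).
have b2 : bounded_weight M w2 := bounded_weight_if (mP rho) (bounded_weight_cst 0) be.
have bt : bounded_weight M t := bounded_weight_if (mP (2 * rho)) (bounded_weight_cst 1) (bounded_weight_cst 0).
have sw w f : bounded_weight M w -> sqint f -> sqint (fun z => w z.1 * f z).
  exact: (@sqint_weight R Omega M oOmega bOmega).
have split f : sqint f -> nrm (fun z => e z.1 * f z) =
    nrm (fun z => w1 z.1 * f z) + nrm (fun z => w2 z.1 * f z).
  move=> sf; rewrite /nrm2 -RintegralD//.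
  - apply: eq_Rintegral => z _; rewrite /w1 /w2; case: ifP => _; ring.
  - exact: (sqint_integrable_sqr (sw _ _ b1 sf)).
  - exact: (sqint_integrable_sqr (sw _ _ b2 sf)).
have W := @weighted_poincare R Omega M oOmega fOmega bOmega.
have H1 : k * nrm (fun z => w1 z.1 * u z) <= nrm (fun z => w1 z.1 * g 1 z).
  by apply: W => // x; rewrite /w1; case: ifP => [Px _|]; [exact: seck|rewrite eqxx].
have H2 : m * nrm (fun z => w2 z.1 * u z) <= nrm (fun z => w2 z.1 * g 1 z).
  by apply: W => // x _; exact: sec.
have := @energy_le R Omega M oOmega fOmega bOmega l u g Hu weak (s * b).
rewrite -/e (split _ su) (split _ (sg 1)) exprMn s1 mul1r.
have H3 : nrm (fun z => w2 z.1 * u z) <= expR (2 * b * rho).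
  have -> : expR (2 * b * rho) = nrm (fun z => expR (b * rho) * u z).
    by rewrite (nrm2Z mOmega)// u1 mulr1 expr2 -expRD; congr expR; ring.
  apply: (le_nrm2 mOmega) => [||z _]; [exact: sw|exact: sqintZ|].
  rewrite !exprMn ler_wpM2r ?sqr_ge0// lerXn2r ?nnegrE ?expR_ge0//.
    by rewrite /w2; case: ifP => _; rewrite ?expR_ge0.
  rewrite /w2 /P; case: ifPn => [_|]; first exact: expR_ge0.
  rewrite -ltNge => /ltW H; rewrite ler_expR mulrAC mulrC.
  exact: ler_wpM2l.
have H4 : nrm (fun z => t z.1 * u z) <= expR (- (4 * b * rho)) * nrm (fun z => w1 z.1 * u z).
  have -> : expR (- (4 * b * rho)) = expR (- (2 * b * rho)) ^+ 2.
    by rewrite expr2 -expRD; congr expR; ring.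
  rewrite -(nrm2Z mOmega); last exact: sw.
  apply: (le_nrm2 mOmega) => [||z _]; [exact: sw|by apply: sqintZ => //; exact: sw|].
  rewrite mulrA [leLHS]exprMn [leRHS]exprMn ler_wpM2r ?sqr_ge0//.
  rewrite lerXn2r ?nnegrE//.
  - by rewrite /t; case: ifP.
  - by rewrite mulr_ge0 ?expR_ge0// /w1; case: ifP => _; rewrite ?expR_ge0.
  rewrite /t; case: ifP => H; last first.
    by rewrite mulr_ge0 ?expR_ge0// /w1; case: ifP => _; rewrite ?expR_ge0.
  rewrite /w1 /P ifT; last by lra.
  rewrite -expRD -[leLHS]expR0 ler_expR.
  have := ler_wpM2l b0 H; lra.
set n1 := nrm (fun z => w1 z.1 * u z) in H1 H4 *.
set n2 := nrm (fun z => w2 z.1 * u z) in H2 H3 *.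
set nt := nrm _ in H4 *.
move=> H5.
(* From k n1 + m n2 <= (l + b^2) (n1 + n2), both Poincare inequalities having been inserted in the
   energy inequality. *)
have H6 : (k - l - b ^+ 2) * n1 <= (l + b ^+ 2 - m) * n2 by lra.
have K0 : 0 <= k - l - b ^+ 2 by lra.
have L0 : 0 <= l + b ^+ 2 - m by have := sqr_ge0 b; lra.
have E0 : 0 <= expR (- (4 * b * rho)) by exact: expR_ge0.
apply: le_trans (ler_wpM2l K0 H4) _.
rewrite mulrCA; apply: le_trans (ler_wpM2l E0 (le_trans H6 (ler_wpM2l L0 H3))) _.
rewrite mulrCA -expRD le_eqVlt; apply/orP; left; apply/eqP; congr (_ * expR _); ring.
Qed.

End exponential_decay_of_eigenfunctions.

(** * Convex sets of finite area are bounded *)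

Section geometry_of_convex_plane_domains.
Context (R : realType).
Notation RB := (measurableTypeR R).
Implicit Types (Omega : set (R * R)).

Lemma open_bounded_intervalE (X : set R) M : open X -> is_interval X -> X !=set0 ->
  (forall x, X x -> `|x| < M) -> exists a b, a < b /\ X = `]a, b[%classic.
Proof.
move=> oX iX [x Xx] XM.
have lX : has_lbound X by exists (- M) => y /XM; rewrite ltr_norml => /andP[/ltW].
have uX : has_ubound X by exists M => y /XM; rewrite ltr_norml => /andP[_ /ltW].
have E : X = `]inf X, sup X[%classic.
  by rewrite -{1}(interior_id X).1// interval_bounded_interior.
exists (inf X), (sup X); split => //.
by have := Xx; rewrite {1}E /= in_itv /= => /andP[]; exact: lt_trans.
Qed.

Lemma convex_planeP Omega : convex_set Omega -> forall (t : R) (p q : R * R), 0 <= t <= 1 ->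
  Omega p -> Omega q -> Omega (t * p.1 + (1 - t) * q.1, t * p.2 + (1 - t) * q.2).
Proof.
move=> cO t p q /andP[t0 t1] Op Oq.
by have := cO p q (Itv01 t0 t1); rewrite !inE => /(_ Op Oq).
Qed.

(** The convex hull of z and the square of half-side r about p lies in Omega. Over the half J of the
    base nearer to p its vertical sections have length at least r, so the area is at least r |z.1 -
    p.1| / 2. *)
Lemma convex_width Omega (A r : R) (p z : R * R) : convex_set Omega -> open Omega ->
  (\int[@lebesgue_measure R]_x (@lebesgue_measure R (xsection Omega x)) <= A%:E)%E ->
  0 < r -> (forall w : R * R, `|w.1 - p.1| < r -> `|w.2 - p.2| < r -> Omega w) -> Omega z ->
  `|z.1 - p.1| <= 2 * A / r.
Proof.
move=> cO oO area r0 sq Oz.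
have [->|zp] := eqVneq z.1 p.1.
  have A0 : 0 <= A by rewrite -lee_fin; apply: le_trans area; exact: integral_ge0.
  by rewrite subrr normr0 divr_ge0 ?mulr_ge0// ltW.
have d0 : 0 < `|z.1 - p.1| by rewrite normr_gt0 subr_eq0.
pose J : set RB := if p.1 <= z.1 then `[p.1, (p.1 + z.1) / 2]%classic else `[(p.1 + z.1) / 2, p.1]%classic.
have mJ : measurable J by rewrite /J; case: ifP => _; exact: measurable_itv.
have lJ : lebesgue_measure J = (`|z.1 - p.1| / 2)%:E.
  rewrite /J; case: ifPn => H; rewrite lebesgue_measure_itv /= lte_fin.
    rewrite ger0_norm ?subr_ge0// in d0 *.
    by rewrite ifT; [rewrite -EFinB; congr EFin; lra|lra].
  rewrite -ltNge in H; rewrite ltr0_norm ?subr_lt0// in d0 *.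
  by rewrite ifT; [rewrite -EFinB; congr EFin; lra|lra].
have tJ x : J x -> exists t, 0 <= t <= 2^-1 /\ x = t * z.1 + (1 - t) * p.1.
  move=> Jx; exists ((x - p.1) / (z.1 - p.1)); split; last by field; rewrite subr_eq0.
  move: Jx; rewrite /J; case: ifPn => H; rewrite /= in_itv /= => /andP[x1 x2].
    have d : 0 < z.1 - p.1 by rewrite -(@ger0_norm _ (z.1 - p.1)) ?subr_ge0.
    by rewrite divr_ge0 ?subr_ge0//= ?(ltW d)// ler_pdivrMr//; lra.
  rewrite -ltNge in H.
  have d : 0 < p.1 - z.1 by lra.
  rewrite -[x - p.1]opprB -[z.1 - p.1]opprB invrN mulrNN.
  apply/andP; split; first by apply: divr_ge0; lra.
  by rewrite ler_pdivrMr//; lra.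
have secJ x : J x -> (r%:E <= @lebesgue_measure R (xsection Omega x))%E.
  move=> /tJ[t [/andP[t0 t2] xE]].
  pose c := t * z.2 + (1 - t) * p.2.
  have -> : r%:E = lebesgue_measure (`]c - r / 2, c + r / 2[%classic : set R).
    by rewrite lebesgue_measure_itv /= lte_fin ifT -?EFinB; [congr EFin; lra|lra].
  apply: le_measure; rewrite ?inE; first exact: measurable_itv.
    exact: measurable_open_section.
  move=> y; rewrite /= in_itv /= => /andP[y1 y2]; apply/xsectionP.
  (* (x, y) lies on the segment from z to the point of the square at signed height s above p. *)
  pose s := (y - c) / (1 - t).
  have t1 : 0 < 1 - t by lra.
  have -> : (x, y) = (t * z.1 + (1 - t) * (p.1, p.2 + s).1, t * z.2 + (1 - t) * (p.1, p.2 + s).2).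
    by rewrite /= -xE; congr (_, _); rewrite /s /c; field; rewrite gt_eqF.
  apply: convex_planeP => //; first by apply/andP; split; lra.
  apply: sq; rewrite /= ?subrr ?normr0// addrC addKr /s normrM normfV (gtr0_norm t1).
  rewrite ltr_pdivrMr//.
  have : `|y - c| < r / 2 by rewrite ltr_norml; apply/andP; split; lra.
  move=> /lt_le_trans; apply; rewrite ler_pM2l//; lra.
suff H : r * (`|z.1 - p.1| / 2) <= A by rewrite ler_pdivlMr//; lra.
rewrite -lee_fin; apply: le_trans area.
apply: (@le_trans _ _ (\int[@lebesgue_measure R]_(x in J) r%:E)%E).
  by rewrite integral_cst// [X in (_ * X)%E]lJ -EFinM.
apply: (@le_trans _ _ (\int[@lebesgue_measure R]_(x in J) (@lebesgue_measure R (xsection Omega x)))%E).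
  apply: ge0_le_integral => //.
  - by move=> x _; rewrite lee_fin ltW.
  - apply: measurable_funTS; apply: measurable_fun_xsection.
    exact: open_measurable_plane.
apply: ge0_subset_integral => //; apply: measurable_fun_xsection.
exact: open_measurable_plane.
Qed.

Lemma leb2_ysection Omega : open Omega ->
  (leb2 R Omega = \int[@lebesgue_measure R]_y (@lebesgue_measure R (ysection Omega y)))%E.
Proof.
move=> oO; have mO := open_measurable_plane oO.
transitivity ((@lebesgue_measure R \x^ @lebesgue_measure R) Omega)%E => //.
apply: (product_measure_unique (m' := (@lebesgue_measure R \x^ @lebesgue_measure R)%E)) => //.
by move=> A1 A2 mA1 mA2; exact: product_measure2E.
Qed.

Let swap (z : R * R) : R * R := (z.2, z.1).

(** [convex_width] bounds the first coordinate; applied to the reflection of Omega in the diagonal,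
    with the area computed by horizontal sections, it bounds the second. *)
Lemma convex_bounded Omega : convex_set Omega -> open Omega -> Omega !=set0 ->
  (leb2 R Omega < +oo)%E -> exists M, forall z, Omega z -> `|z.1| < M /\ `|z.2| < M.
Proof.
move=> cO oO [p Op] fO; set A := fine (leb2 R Omega).
have AE : leb2 R Omega = A%:E by rewrite fineK// ge0_fin_numE.
have /nbhs_ballP[r /= r0 rO] := open_nbhs_nbhs (conj oO Op).
have sq w : `|w.1 - p.1| < r -> `|w.2 - p.2| < r -> Omega w.
  by move=> w1 w2; apply: rO; split; rewrite /ball /= distrC.
have [B HB] : exists B, forall z, Omega z -> `|z.1 - p.1| <= B.
  exists (2 * A / r) => z Oz; apply: (@convex_width Omega A r p z) => //.
  by rewrite -AE.
have [C HC] : exists C, forall z, Omega z -> `|z.2 - p.2| <= C.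
  exists (2 * A / r) => z Oz.
  apply: (@convex_width (swap @^-1` Omega) A r (swap p) (swap z)) => //.
  - move=> x y t; rewrite !inE /= => Ox Oy.
    by have := cO _ _ t (mem_set Ox) (mem_set Oy); rewrite inE.
  - apply: open_comp => // w _.
    exact: (@cvg_pair _ _ _ (nbhs w) (nbhs w.2) (nbhs w.1) _ _ _ snd fst cvg_snd cvg_fst).
  - rewrite -AE leb2_ysection// (eq_integral (fun y => lebesgue_measure (ysection Omega y)))//.
  - by move=> w w1 w2; apply: sq.
  - by case: z Oz.
exists (B + C + `|p.1| + `|p.2| + 1) => z Oz.
have := HB z Oz; have := HC z Oz.
have := ler_normD (z.1 - p.1) p.1; have := ler_normD (z.2 - p.2) p.2; rewrite !subrK.
have := normr_ge0 p.1; have := normr_ge0 p.2.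
have := normr_ge0 (z.1 - p.1); have := normr_ge0 (z.2 - p.2).
by split; lra.
Qed.

Lemma convex_section_interval Omega x : convex_set Omega -> is_interval (xsection Omega x).
Proof.
move=> cO; apply/is_intervalPlt => y1 y2 /xsectionP O1 /xsectionP O2 y /andP[y1y yy2].
apply/xsectionP; pose t := (y2 - y) / (y2 - y1).
have d : 0 < y2 - y1 by lra.
have t01 : 0 <= t <= 1.
  by rewrite /t divr_ge0 ?ler_pdivrMr//=; lra.
have := convex_planeP cO t01 O1 O2; rewrite /=.
rewrite (_ : t * x + (1 - t) * x = x); last by ring.
by rewrite (_ : t * y1 + (1 - t) * y2 = y)//; rewrite /t; field; rewrite gt_eqF.
Qed.

Lemma open_xsection Omega x : open Omega -> open (xsection Omega x).
Proof.
move=> oO; rewrite xsectionE; apply: open_comp => // y _.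
exact: (@cvg_pair _ _ _ (nbhs y) (nbhs x) (nbhs y) _ _ _ (cst x) id (cvg_cst x) cvg_id).
Qed.

Lemma sections_union_interval Omega : convex_set Omega -> is_interval (sections_union Omega).
Proof.
move=> cO; apply/is_intervalPlt => y1 y2 [x1 _ /xsectionP O1] [x2 _ /xsectionP O2] y /andP[y1y yy2].
pose t := (y2 - y) / (y2 - y1).
have d : 0 < y2 - y1 by lra.
have t01 : 0 <= t <= 1.
  by rewrite /t divr_ge0 ?ler_pdivrMr//=; lra.
exists (t * x1 + (1 - t) * x2) => //; apply/xsectionP.
have := convex_planeP cO t01 O1 O2; rewrite /=.
by rewrite (_ : t * y1 + (1 - t) * y2 = y)//; rewrite /t; field; rewrite gt_eqF.
Qed.

Lemma open_sections_union Omega : open Omega -> open (sections_union Omega).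
Proof. by move=> oO; apply: bigcup_open => x _; exact: open_xsection. Qed.

End geometry_of_convex_plane_domains.

(** * Tails of the ground state and its L^1 norm *)

Section tail_of_the_ground_state.
Context (R : realType).
Notation RB := (measurableTypeR R).
Variables (Omega : set (R * R)) (M : R).
Hypothesis oOmega : open Omega.
Hypothesis fOmega : (leb2 R Omega < +oo)%E.
Hypothesis bOmega : forall z, Omega z -> `|z.1| < M /\ `|z.2| < M.

Notation sqint := (square_integrable (leb2 R) Omega).
Notation nrm := (nrm2 (leb2 R) Omega).
Notation A := (fine (leb2 R Omega)).

Let mOmega : measurable (Omega : set (RB * RB)).
Proof. exact: open_measurable_plane. Qed.

Definition tail (s r : R) (u : R * R -> R) (z : R * R) :=
  (if r <= s * z.1 then 1 else 0) * u z.

Lemma measurable_half_plane (s r : R) :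
  measurable_fun [set: RB * RB] ((fun z => r <= s * z.1) : RB * RB -> bool).
Proof.
apply: measurable_fun_ler; first exact: measurable_cst.
by apply: measurable_funM; [exact: measurable_cst|exact: measurable_fst].
Qed.

Lemma sqint_tail s r u : sqint u -> sqint (tail s r u).
Proof.
move=> su; apply: (@sqint_bounded_mul R _ _ (leb2 R) Omega mOmega
  (fun z => if r <= s * z.1 then 1 else 0) 1 u) => //; last first.
  by move=> z _; case: ifP => _; rewrite ?normr1 ?normr0.
apply: measurable_funTS; apply: measurable_fun_ifT => //; exact: measurable_half_plane.
Qed.

(* agmon_tail with b^2 = (lam - m) K / 2, for which b r >= K. *)
Lemma tail_le (l lam m K c s r : R) u g :
  H10 (leb2 R) (@test2 R) (@partial2 R) Omega u g ->
  (forall w h, H10 (leb2 R) (@test2 R) (@partial2 R) Omega w h ->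
    \int[leb2 R]_(x in Omega) (\sum_(i < 2) g i x * h i x) =
    \int[leb2 R]_(x in Omega) (l * u x * w x)) ->
  nrm u = 1 -> 0 <= m -> (forall x, narrow_section Omega m x) ->
  m < l -> l <= lam -> 0 < K -> 1 <= c -> s ^+ 2 = 1 -> 0 <= r ->
  2 * K <= (lam - m) * r ^+ 2 ->
  (forall x, r / 2 <= s * x -> narrow_section Omega (m + 2 * (lam - m) * (K + c)) x) ->
  nrm (tail s r u) <= 2 * expR (- K).
Proof.
move=> Hu weak u1 m0 sec ml llam K0 c1 s1 r0 rK narrow.
pose kap := lam - m; have kap0 : 0 < kap by rewrite /kap; lra.
rewrite -/kap in rK narrow.
pose b := Num.sqrt (kap * K / 2).
have b2 : b ^+ 2 = kap * K / 2 by rewrite sqr_sqrtr// divr_ge0// mulr_ge0// ltW.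
have b0 : 0 <= b by exact: sqrtr_ge0.
have kK : 0 < kap * K by rewrite mulr_gt0.
have kc : kap <= kap * c by rewrite ler_peMr// ltW.
have br : K <= b * r.
  rewrite -(@ler_pXn2r _ 2)// ?nnegrE ?mulr_ge0 ?(ltW K0)//.
  rewrite exprMn b2.
  have := ler_wpM2l (ltW K0) rK; nra.
have := @agmon_tail R Omega M oOmega fOmega bOmega l m u g Hu weak u1 m0 sec s b (r / 2)
  (m + 2 * kap * (K + c)) s1 b0.
have -> : - (2 * b * (r / 2)) = - (b * r) by field.
have -> : nrm (fun z => (if 2 * (r / 2) <= s * z.1 then 1 else 0) * u z) = nrm (tail s r u).
  by rewrite (_ : 2 * (r / 2) = r); last by field.
set n := nrm (tail s r u); have n0 : 0 <= n by exact: nrm2_ge0.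
have k0 : 0 <= m + 2 * kap * (K + c) by lra.
have H1 : l + b ^+ 2 <= m + 2 * kap * (K + c) by rewrite b2; rewrite /kap in kK kc *; lra.
move=> /(_ _ k0 (ltW ml) H1 narrow) H.
have {}H := H (divr_ge0 r0 (ler0n _ 2)).
have E : expR (- (b * r)) <= expR (- K) by rewrite ler_expR lerN2.
set q := expR (- K) in E *; have q0 : 0 < q by exact: expR_gt0.
have L0 : 0 <= l + b ^+ 2 - m by have := sqr_ge0 b; lra.
have H2 := le_trans H (ler_wpM2l L0 E).
(* Since l <= lam and c >= 1, the coefficient k - l - b^2 is at least kap (1 + 3/2 K), while l + b^2
   - m is at most kap (1 + K/2). *)
have H3 : kap * (1 + 3 / 2 * K) * n <= (kap * (1 + K / 2)) * q.
  apply: le_trans (_ : (l + b ^+ 2 - m) * q <= _); last first.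
    by rewrite ler_pM2r// b2 /kap; lra.
  apply: le_trans H2; rewrite ler_wpM2r// b2.
  have : kap * (1 + 3 / 2 * K) = kap + 3 / 2 * (kap * K) by ring.
  move=> ->; have -> : 2 * kap * (K + c) = 2 * (kap * K) + 2 * (kap * c) by ring.
  by rewrite {1}/kap; rewrite /kap in kK kc *; lra.
have H4 : (1 + 3 / 2 * K) * n <= (1 + K / 2) * q.
  by rewrite -(ler_pM2l kap0) !mulrA.
have D0 : 0 < 1 + 3 / 2 * K by lra.
rewrite -(ler_pM2l D0); apply: le_trans H4 _.
have : 0 <= K * q by rewrite mulr_ge0// ltW.
lra.
Qed.

Lemma mass_split (I : set R) (u : R * R -> R) (r1 r2 L : R) : sqint u -> nrm u = 1 ->
  0 < r1 -> 0 < r2 -> measurable (I : set RB) -> @lebesgue_measure R I = L%:E ->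
  (forall z, Omega z -> I z.2) ->
  ((\int[leb2 R]_(z in Omega) `|u z|%:E) ^+ 2 <=
   (2 * (L * (r1 + r2)) + 2 * (A * (nrm (tail 1 r1 u) + nrm (tail (-1) r2 u))))%:E)%E.
Proof.
move=> su u1 r10 r20 mI LI OI.
have AE : leb2 R Omega = A%:E by rewrite fineK// ge0_fin_numE.
have A0 : 0 <= A by exact: fine_ge0.
have sabs : sqint (fun z => `|u z|).
  split; first by apply: measurableT_comp => //; exact: sqint_measurable su.
  by have [_] := su; under eq_integral do rewrite -(real_normK (num_real _)).
have s1 : sqint (fun=> 1 : R).
  by apply: (@sqint_bounded _ _ _ (leb2 R) Omega mOmega _ 1 fOmega) => // z _; rewrite normr1.
pose T (z : R * R) : R := if r1 <= 1 * z.1 then 0 else if r2 <= -1 * z.1 then 0 else 1.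
have mT : measurable_fun [set: RB * RB] (T : RB * RB -> R).
  apply: measurable_fun_ifT => //; first exact: measurable_half_plane.
  by apply: measurable_fun_ifT => //; exact: measurable_half_plane.
have sT : sqint T.
  apply: (@sqint_bounded _ _ _ (leb2 R) Omega mOmega _ 1 fOmega).
    exact: measurable_funTS.
  move=> z _; rewrite /T; case: ifP => _; first by rewrite normr0.
  by case: ifP => _; rewrite ?normr0 ?normr1.
(* As r1 and r2 are positive the two tails have disjoint supports: |u| = T |u| + |v|, and v^2 is the
   sum of the squared tails. *)
have disj (z : R * R) : r1 <= 1 * z.1 -> ~~ (r2 <= -1 * z.1) by rewrite -ltNge; lra.
pose v z := tail 1 r1 u z + tail (-1) r2 u z.
have t1 := sqint_tail 1 r1 su; have t2 := sqint_tail (-1) r2 su.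
have sv : sqint v by exact: sqintD.
have svabs : sqint (fun z => `|v z|).
  split; first by apply: measurableT_comp => //; exact: sqint_measurable sv.
  by have [_] := sv; under eq_integral do rewrite -(real_normK (num_real _)).
have iJ : (leb2 R).-integrable Omega (EFin \o (fun z => `|u z|)).
  have := sqint_integrable_mul mOmega s1 sabs.
  by apply: eq_integrable => // z _ /=; rewrite mul1r.
have -> : (\int[leb2 R]_(z in Omega) `|u z|%:E =
    (\int[leb2 R]_(z in Omega) `|u z|)%:E)%E.
  by rewrite /Rintegral fineK//; exact: integrable_fin_num.
rewrite -EFin_expe lee_fin.
have -> : \int[leb2 R]_(z in Omega) `|u z| =
    \int[leb2 R]_(z in Omega) (T z * `|u z|) + \int[leb2 R]_(z in Omega) (1 * `|v z|).
  rewrite -RintegralD//; last 2 first.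
  - exact: sqint_integrable_mul.
  - exact: sqint_integrable_mul.
  apply: eq_Rintegral => z _; rewrite /T /v /tail.
  case: ifP => h1; first by rewrite (ifN _ _ (disj z h1)) !mul0r !mul1r addr0 add0r.
  by case: ifP => h2; rewrite !(mul0r, mul1r, add0r, normr0, addr0).
set a := \int[leb2 R]_(z in Omega) (T z * _); set b := \int[leb2 R]_(z in Omega) (1 * _).
have Ha : a ^+ 2 <= L * (r1 + r2).
  apply: le_trans (cauchy_schwarz mOmega sT sabs) _.
  have -> : nrm (fun z => `|u z|) = 1.
    by rewrite -u1; apply: eq_Rintegral => z _; rewrite real_normK ?num_real.
  rewrite mulr1 -lee_fin -(nrm2E mOmega sT).
  pose P : set (RB * RB) := `](- r2), r1[%classic `*` I.
  have mP : measurable P by apply: measurableX => //; exact: measurable_itv.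
  apply: (@le_trans _ _ (\int[leb2 R]_(z in Omega) (\1_P z)%:E)%E).
    apply: ge0_le_integral => //.
    - by move=> z _; rewrite lee_fin sqr_ge0.
    - by apply/measurable_EFinP/measurable_funX; exact: measurable_funTS.
    - by apply/measurable_EFinP; exact: measurable_funTS.
    move=> z Oz; rewrite lee_fin /T; case: ifPn => h1; first by rewrite expr0n.
    case: ifPn => h2; first by rewrite expr0n.
    rewrite expr1n indicE mem_set//; split; last exact: OI.
    by rewrite /= in_itv /=; apply/andP; split; move: h1 h2; rewrite -!ltNge; lra.
  rewrite integral_indic//.
  apply: (@le_trans _ _ (leb2 R P)).
    by apply: le_measure; rewrite ?inE//; exact: measurableI.
  rewrite /leb2 /= product_measure1E//.
  rewrite [X in (_ * X <= _)%E]LI [X in (X * _ <= _)%E]lebesgue_measure_itv /= lte_fin ifT; last by lra.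
  by rewrite -EFinB -EFinM lee_fin; lra.
have Hb : b ^+ 2 <= A * (nrm (tail 1 r1 u) + nrm (tail (-1) r2 u)).
  apply: le_trans (cauchy_schwarz mOmega s1 svabs) _.
  rewrite (_ : nrm (fun=> 1) = A); last first.
    rewrite /nrm2; under eq_Rintegral do rewrite expr1n.
    by rewrite Rintegral_cst// mul1r.
  apply: ler_wpM2l => //; rewrite /nrm2 -RintegralD//; last 2 first.
  - exact: (sqint_integrable_sqr t1).
  - exact: (sqint_integrable_sqr t2).
  rewrite le_eqVlt; apply/orP; left; apply/eqP; apply: eq_Rintegral => z _.
  rewrite real_normK ?num_real// /v /tail; case: ifP => h1; last by rewrite mul0r expr0n !add0r.
  by rewrite (ifN _ _ (disj z h1)) !mul0r expr0n !addr0.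
have := sqr_ge0 (a - b); lra.
Qed.

End tail_of_the_ground_state.

(** * Points outside a bounded set, close to its first gaps *)

Section outer_measure.
Context (R : realType).

(** In either direction take the infimum of the points beyond X0 outside S: S fills the interval
    from X0 up to it. The infimum may belong to S, so r1 and r2 are points outside S within e of
    it. *)
Lemma gap_outer_measure (S : set R) (X0 B e : R) : 0 < X0 -> (forall x, B <= `|x| -> ~ S x) ->
  0 < e -> exists r1 r2, [/\ X0 <= r1, X0 <= r2, ~ S r1, ~ S (- r2) &
    ((r1 + r2 - 2 * X0 - 2 * e)%:E <= leb1 R S)%E].
Proof.
move=> X00 SB e0.
have gap (f : R -> R) : (forall x, `|f x| = `|x|) -> exists r r',
    [/\ X0 <= r', r' <= r, r - e <= r', ~ S (f r) & forall x, X0 < x -> x < r' -> S (f x)].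
  move=> fE; pose Q := [set x | X0 <= x /\ ~ S (f x)].
  have Q0 : Q !=set0.
    exists (`|X0| + `|B|); split; first by rewrite (le_trans (ler_norm X0))// lerDl.
    apply: SB; rewrite fE ger0_norm ?addr_ge0//.
    by rewrite (le_trans (ler_norm B))// lerDr.
  have lQ : lbound Q X0 by move=> x [].
  have hQ : has_inf Q by split => //; exists X0.
  have [r [Xr nr] re] := inf_adherent e0 hQ.
  exists r, (inf Q); split => //.
  - exact: lb_le_inf.
  - by apply: ge_inf => //; exists X0.
  - by rewrite lerBlDr ltW.
  - move=> x Xx xi; apply: contrapT => nS; move: xi; rewrite ltNge => /negP; apply.
    by apply: ge_inf; [exists X0|split => //; exact: ltW].
have [r1 [r1' [X1 le1 e1 n1 S1]]] := gap id (fun=> erefl).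
have [r2 [r2' [X2 le2 e2 n2 S2]]] := gap -%R (@normrN _ _).
exists r1, r2; split; [lra|lra|by []|by []|].
pose I1 : set (measurableTypeR R) := `]X0, r1'[%classic.
pose I2 : set (measurableTypeR R) := `](- r2'), (- X0)[%classic.
have m1 : measurable I1 by exact: measurable_itv.
have m2 : measurable I2 by exact: measurable_itv.
have sub : I1 `|` I2 `<=` S.
  move=> x [|]; rewrite /I1 /I2 /= in_itv /= => /andP[x1 x2]; first exact: S1.
  by rewrite -(opprK x); apply: S2; lra.
(* Monotonicity of the outer measure, which applies to S without measurability. *)
apply: (@le_trans _ _ (leb1 R (I1 `|` I2))); last exact: le_outer_measure.
rewrite measureU//; last first.
  apply/seteqP; split => x //=; rewrite /I1 /I2 /= !in_itv /= => -[/andP[x1 x2] /andP[x3 x4]].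
  by move: (lt_trans x1 x4); rewrite ltNge => /negP; apply; lra.
have len a b : a <= b -> lebesgue_measure (`]a, b[%classic : set R) = (b - a)%:E.
  move=> ab; rewrite lebesgue_measure_itv /= lte_fin; case: ltP => // ba.
  by rewrite (_ : b = a) ?subrr//; apply/eqP; rewrite eq_le ba ab.
rewrite [X in (_ <= X + _)%E]len// [X in (_ <= _ + X)%E]len; last by lra.
by rewrite -EFinD lee_fin; lra.
Qed.

End outer_measure.

(** * From the definition of S to narrow sections; the constants *)

Section first_eigenvalue_of_sections.
Context (R : realType).
Notation RB := (measurableTypeR R).
Implicit Types (Omega : set (R * R)) (s r x : R).

Lemma mu1_set0 : mu1 (set0 : set R) = +oo%E.
Proof.
rewrite /mu1 /first_eigenvalue (_ : [set _ | _ in _] = set0) ?ereal_inf0//.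
by apply/seteqP; split => // x [l [v [_ nz]] _]; apply: nz; exact: aeW.
Qed.

(** A non-empty section over x0 is a bounded open interval, and [mu1_itv_le] bounds its length by
    means of k. An empty one has no length to compare, and an interval of length pi / sqrt k serves
    instead. *)
Lemma narrow_section_mu1 Omega M k x0 x : convex_set Omega -> open Omega ->
  (forall z, Omega z -> `|z.1| < M /\ `|z.2| < M) -> 0 < k ->
  (k%:E <= mu1 (xsection Omega x0))%E -> xsection Omega x `<=` xsection Omega x0 ->
  narrow_section Omega k x.
Proof.
move=> cO oO bO k0 kmu sub.
have [E|/set0P ne] := eqVneq (xsection Omega x0) set0.
  exists 0, (pi / Num.sqrt k); rewrite E in sub.
  have sk : 0 < Num.sqrt k by rewrite sqrtr_gt0.
  split; [by rewrite divr_gt0 ?pi_gt0|by move=> y /sub|].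
  have -> : pi / (pi / Num.sqrt k - 0) = Num.sqrt k.
    by rewrite subr0 invf_div mulrCA divff ?mulr1// gt_eqF// pi_gt0.
  by rewrite sqr_sqrtr// ltW.
have [||||a [b [ab E]]] := @open_bounded_intervalE R (xsection Omega x0) M.
- exact: open_xsection.
- exact: convex_section_interval.
- exact: ne.
- by move=> y /xsectionP /bO[].
exists a, b; rewrite -E; split => //.
by rewrite -lee_fin (le_trans kmu)// E; exact: mu1_itv_le.
Qed.

Lemma horn_section_subset Omega s r x : horn_shaped Omega -> s = 1 \/ s = -1 -> 0 < r ->
  r / 2 <= s * x -> xsection Omega x `<=` xsection Omega (s * r / 2).
Proof.
move=> [_ _ hp hn] [->|->] r0; rewrite ?mul1r ?mulN1r le_eqVlt => /predU1P[E|H].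
- by rewrite E.
- by apply: hp => //; lra.
- by rewrite mulNr E opprK.
- by apply: hn; lra.
Qed.

(** The inequality defining S, negated and solved for the eigenvalue e; the result is the threshold
    of [tail_le]. The value -oo is excluded because it would satisfy that inequality. *)
Lemma mu1_gt_of_quotient (e : \bar R) (L lam K : R) : 0 < L -> 0 < L ^+ 2 * lam - pi ^+ 2 ->
  ~ (((L ^+ 2)%:E * e - (pi ^+ 2)%:E) * ((2 * (L ^+ 2 * lam - pi ^+ 2))^-1)%:E <= K%:E)%E ->
  (((pi / L) ^+ 2 + 2 * (lam - (pi / L) ^+ 2) * K)%:E <= e)%E.
Proof.
move=> L0 d0; have D0 : 0 < (2 * (L ^+ 2 * lam - pi ^+ 2))^-1 by rewrite invr_gt0 mulr_gt0.
have L20 : 0 < L ^+ 2 by rewrite exprn_gt0.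
case: e => [e| |].
- rewrite (_ : (_ * _)%E = ((L ^+ 2 * e - pi ^+ 2) / (2 * (L ^+ 2 * lam - pi ^+ 2)))%:E)//.
  move/negP; rewrite !lee_fin -ltNge => H.
  rewrite -(ler_pM2l L20) mulrDr; move: H; rewrite ltr_pdivlMr ?mulr_gt0// => /ltW H.
  rewrite [X in X + _](_ : _ = pi ^+ 2); last by field; rewrite gt_eqF.
  rewrite [X in _ + X](_ : _ = K * (2 * (L ^+ 2 * lam - pi ^+ 2))); first by lra.
  by field; rewrite gt_eqF.
- by rewrite leey.
- by move=> H; exfalso; apply: H; rewrite gt0_muleNy ?lte_fin// addNye gt0_mulNye ?lte_fin// leNye.
Qed.

(** Twice ln (1 + x) <= x at x = -1/2. This is the condition 1 <= c of [tail_le] for the surplus log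
    4 in S. *)
Lemma ln4_ge1 : 1 <= ln 4 :> R.
Proof.
have h : ln (2^-1) <= - 2^-1 :> R.
  by have := @le_ln1Dx R (- 2^-1); rewrite (_ : 1 + - 2^-1 = 2^-1); [apply; lra|lra].
have -> : 4 = (2^-1 * 2^-1)^-1 :> R by field.
rewrite lnV ?posrE ?mulr_gt0 ?invr_gt0// lnM ?posrE ?invr_gt0//; lra.
Qed.

(** The last term of the statement is 2 L / A times the width 2 X_0 of the central strip: 2^(5/2) =
    4 sqrt 2, and one factor L cancels against the square root of L^2. *)
Lemma corollary_constantE (L A lam K : R) : 0 < L -> 0 < L ^+ 2 * lam - pi ^+ 2 -> 0 <= K ->
  2 `^ (5 / 2) * L ^+ 2 / A * (L ^+ 2 * lam - pi ^+ 2) `^ (- (1 / 2)) * K `^ (1 / 2) =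
  2 * L / A * (2 * Num.sqrt (2 * K / (lam - (pi / L) ^+ 2))).
Proof.
move=> L0 d0 K0; set kap := lam - _.
have -> : L ^+ 2 * lam - pi ^+ 2 = L ^+ 2 * kap by rewrite /kap; field; rewrite gt_eqF.
have kap0 : 0 < kap.
  rewrite -(@pmulr_rgt0 _ (L ^+ 2)) ?exprn_gt0//.
  by rewrite (_ : _ * _ = L ^+ 2 * lam - pi ^+ 2)// /kap; field; rewrite gt_eqF.
have -> : (5 / 2 : R) = 2%:R + 2^-1 by field.
rewrite powRD; last by apply/implyP => _; rewrite pnatr_eq0.
rewrite powR_mulrn// !mul1r powRN !powR12_sqrt ?mulr_ge0 ?exprn_ge0 ?(ltW L0) ?(ltW kap0)//.
rewrite sqrtrM ?exprn_ge0 ?(ltW L0)// sqrtr_sqr (gtr0_norm L0).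
rewrite sqrtrM ?mulr_ge0// sqrtrM// sqrtrV ?(ltW kap0)//.
have sk : Num.sqrt kap != 0 by rewrite gt_eqF// sqrtr_gt0.
have [->|An0] := eqVneq A 0; first by rewrite invr0 !mulr0 !mul0r.
by field; rewrite sk An0 gt_eqF.
Qed.

End first_eigenvalue_of_sections.


Theorem corollary7 (R : realType) (Omega : set (R * R)) (u : R * R -> R)
    (lam eps : R) :
  Omega !=set0 ->
  convex_set Omega ->
  horn_shaped Omega ->
  (leb2 R Omega < +oo)%E ->
  is_ground_state Omega u ->
  (lambda1 Omega <= lam%:E)%E ->
  ((2^-1 * lam)%:E <= mu1 (sections_union Omega))%E ->
  0 < eps ->
  (eps%:E < leb2 R Omega * mu1 (sections_union Omega))%E ->
  let A := fine (leb2 R Omega) in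
  (* finite: a convex open plane set of finite area is bounded *)
  let L := fine (leb1 R (sections_union Omega)) in
  (* the left-hand side is +oo when the section is empty *)
  let S := [set x1 : R |
    (((L ^+ 2)%:E * mu1 (xsection Omega (x1 / 2)%R) - (pi ^+ 2)%:E)
       * ((2 * (L ^+ 2 * lam - pi ^+ 2))^-1)%:E
     <= (ln (4 * pi ^+ 2 * eps^-1 * L ^- 2 * A))%:E)%E] in
  (A^-1%:E * (\int[leb2 R]_(x in Omega) `|u x|%:E) ^+ 2
   <= (2 * eps)%:E
      + (2 * L / A)%:E * leb1 R S
      + (2 `^ (5 / 2) * L ^+ 2 / A
         * (L ^+ 2 * lam - pi ^+ 2) `^ (- (1 / 2))
         * ln (pi ^+ 2 * eps^-1 * L ^- 2 * A) `^ (1 / 2))%:E)%E.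
Proof.
move=> ne cO horn fO [[l El [[_ [g Hu weak]] _]] _ u2] llam lmu e0 eA; cbv zeta.
set A := fine (leb2 R Omega); set L := fine (leb1 R _); set S := [set x1 | _].
have [oO _ hp hn] := horn.
have mO := open_measurable_plane oO.
have [M bO] := convex_bounded cO oO ne fO.
have [||||c [d [cd OE]]] := @open_bounded_intervalE R (sections_union Omega) M.
- exact: open_sections_union.
- exact: sections_union_interval.
- by case: ne => z Oz; exists z.2, z.1 => //; apply/xsectionP; case: z Oz.
- by move=> y [x _ /xsectionP /bO[]].
have LE : leb1 R (sections_union Omega) = L%:E.
  rewrite /L OE [leb1 R _]lebesgue_measure_itv /= lte_fin cd.
  by rewrite -EFinB.
have LE2 : L = d - c.
  by rewrite /L OE [leb1 R _]lebesgue_measure_itv /= lte_fin cd.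
have L0 : 0 < L by rewrite LE2 subr_gt0.
pose m := (pi / L) ^+ 2.
have m0 : 0 <= m by exact: sqr_ge0.
have mum : (mu1 (sections_union Omega) <= m%:E)%E by rewrite /m LE2 OE; exact: mu1_itv_le.
have su : square_integrable (leb2 R) Omega u by case: Hu.
have u1 : nrm2 (leb2 R) Omega u = 1.
  by move: u2; rewrite (nrm2E mO su) => -[].
have secm x : narrow_section Omega m x.
  exists c, d; split => //; last by rewrite /m LE2.
  by rewrite -OE => y xy; exists x.
have [ml Al] := eigenvalue_bounds oO fO bO Hu weak u1 m0 secm.
rewrite -/A in Al.
have {}llam : l <= lam by rewrite -lee_fin El.
have lam2m : lam <= 2 * m.
  have : ((2^-1 * lam)%:E <= m%:E)%E by exact: le_trans lmu mum.
  by rewrite lee_fin; lra.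
have AE : leb2 R Omega = A%:E by rewrite fineK// ge0_fin_numE.
have A0 : 0 <= A by exact: fine_ge0.
have Am : 4 <= A * m.
  have := ler_wpM2l A0 (le_trans llam lam2m); lra.
have Apos : 0 < A.
  by rewrite lt_neqAle A0 andbT; apply: contraTneq Am => <-; rewrite mul0r -ltNge.
(* This is X > 1, hence K > 0: the range of eps keeps the logarithms positive. *)
have eAm : eps < A * m.
  rewrite -lte_fin; apply: lt_le_trans eA _.
  by rewrite AE EFinM; apply: lee_wpmul2l => //; rewrite lee_fin.
pose X := pi ^+ 2 * eps^-1 * L ^- 2 * A; pose K := ln X.
have XE : X = A * m / eps by rewrite /X /m; field; rewrite !gt_eqF.
have X1 : 1 < X by rewrite XE ltr_pdivlMr// mul1r.
have Xp : 0 < X := lt_trans ltr01 X1.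
have K0 : 0 < K by rewrite ln_gt0.
have XK : expR (- K) = eps / (A * m).
  by rewrite expRN lnK ?posrE// XE invf_div.
have lnE : ln (4 * pi ^+ 2 * eps^-1 * L ^- 2 * A) = K + ln 4.
  rewrite (_ : 4 * _ * _ * _ * A = 4 * X); last by rewrite /X !mulrA.
  by rewrite lnM ?posrE// addrC.
have dE : L ^+ 2 * lam - pi ^+ 2 = L ^+ 2 * (lam - m).
  by rewrite /m; field; rewrite gt_eqF.
have d0 : 0 < L ^+ 2 * lam - pi ^+ 2.
  by rewrite dE mulr_gt0 ?exprn_gt0// subr_gt0 (lt_le_trans ml).
have kap0 : 0 < lam - m by rewrite subr_gt0 (lt_le_trans ml).
pose X0 := Num.sqrt (2 * K / (lam - m)).
have X00 : 0 < X0 by rewrite sqrtr_gt0 divr_gt0// mulr_gt0.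
have X0E : (lam - m) * X0 ^+ 2 = 2 * K.
  rewrite sqr_sqrtr; first by field; rewrite gt_eqF.
  by rewrite divr_ge0 ?mulr_ge0// ltW.
have half (s r : R) : s = 1 \/ s = -1 -> X0 <= r -> ~ S (s * r) ->
    nrm2 (leb2 R) Omega (tail s r u) <= eps / 2.
  move=> s1 Xr nS; have r0 : 0 < r := lt_le_trans X00 Xr.
  have k0 : 0 < m + 2 * (lam - m) * (K + ln 4).
    have := @ln4_ge1 R => h4; have : 0 < (lam - m) * (K + ln 4) by rewrite mulr_gt0//; lra.
    lra.
  have kmu : ((m + 2 * (lam - m) * (K + ln 4))%:E <= mu1 (xsection Omega (s * r / 2)%R))%E.
    by apply: mu1_gt_of_quotient => //; move: nS; rewrite /S /= lnE.
  have := @tail_le R Omega M oO fO bO l lam m K (ln 4) s r u g Hu weak u1 m0 secm ml llam K0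
    (@ln4_ge1 R).
  move=> /(_ _ (ltW r0)) H; apply: le_trans (H _ _ _) _.
  - by case: s1 => ->; rewrite ?sqrrN expr1n.
  - by rewrite -X0E ler_pM2l// lerXn2r ?nnegrE// ltW.
  - move=> x rx; apply: (narrow_section_mu1 cO oO bO k0 kmu).
    exact: horn_section_subset.
  (* The tail is at most 2 e^(-K) = 2 eps / (A m), which is at most eps / 2 because A m >= 4. *)
  rewrite XK; have Am0 : 0 < A * m by lra.
  rewrite mulrA ler_pdivrMr//.
  have := ler_wpM2l (ltW e0) Am; lra.
(* S is bounded: for |x / 2| >= |M| the section over x / 2 is empty, its first eigenvalue is +oo and
   the inequality defining S fails. *)
have SB x : 2 * `|M| <= `|x| -> ~ S x.
  move=> xM; rewrite /S /= (_ : xsection Omega (x / 2) = set0).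
    rewrite mu1_set0 gt0_muley ?lte_fin ?exprn_gt0// addye// gt0_mulye ?lte_fin ?invr_gt0 ?mulr_gt0//.
  apply/seteqP; split => // y /xsectionP /bO[/= xb _]; move: xb; apply/negP.
  rewrite -leNgt normrM normfV (@ger0_norm _ 2)// ler_pdivlMr// mulrC.
  by apply: le_trans xM; rewrite ler_pM2l// ler_norm.
rewrite corollary_constantE ?(ltW K0)// -/X0.
apply/lee_addgt0Pr => e' e'0.
pose c' := 2 * L / A; have c'0 : 0 < c' by rewrite divr_gt0// mulr_gt0.
(* Chosen so that the loss 2 del in the choice of r1 and r2 contributes exactly e'. *)
pose del := e' / (2 * c'); have del0 : 0 < del by rewrite divr_gt0// mulr_gt0.
have [r1 [r2 [Xr1 Xr2 nS1 nS2 gap]]] := gap_outer_measure X00 SB del0.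
have mI : measurable (sections_union Omega : set (measurableTypeR R)).
  by rewrite OE; exact: measurable_itv.
have OI z : Omega z -> sections_union Omega z.2.
  by move=> Oz; exists z.1 => //; apply/xsectionP; case: z Oz.
have mass := @mass_split R Omega oO fO (sections_union Omega) u r1 r2 L su u1
  (lt_le_trans X00 Xr1) (lt_le_trans X00 Xr2) mI LE OI.
have n1 : nrm2 (leb2 R) Omega (tail 1 r1 u) <= eps / 2.
  by apply: half => //; [left|rewrite mul1r].
have n2 : nrm2 (leb2 R) Omega (tail (-1) r2 u) <= eps / 2.
  by apply: half => //; [right|rewrite mulN1r].
have Ai0 : (0 <= (A^-1)%:E)%E by rewrite lee_fin invr_ge0.
apply: le_trans (lee_wpmul2l Ai0 mass) _.
have c'0' : (0 <= c'%:E)%E by rewrite lee_fin ltW.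
(* r1 + r2 is split into the part bounded by the measure of S, the 2 X0 of the last term and the
   loss 2 del. *)
apply: (@le_trans _ _ ((2 * eps)%:E + c'%:E * (r1 + r2 - 2 * X0 - 2 * del)%:E +
  (c' * (2 * X0))%:E + e'%:E)%E); last first.
  by rewrite leeD2r// leeD2r// leeD2l// lee_wpmul2l.
rewrite -!EFinM -!EFinD lee_fin -/A.
set n := nrm2 _ _ _ + nrm2 _ _ _; have nle : n <= eps by rewrite /n; lra.
have -> : A^-1 * (2 * (L * (r1 + r2)) + 2 * (A * n)) = c' * (r1 + r2) + 2 * n.
  by rewrite /c'; field; rewrite gt_eqF.
have E : c' * (2 * del) = e' by rewrite /del; field; rewrite gt_eqF.
rewrite -E; lra.
Qed.
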